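(* Let $f\colon\Delta\to\Sigma$ be a subdivision of fans, regarded as a morphism of monoschemes, and let $P$ be a valuative monoid. Then for every morphism of monoschemes $g\colon\operatorname{Spec} P\to\Sigma$, the projection $\operatorname{Spec} P\times_{\Sigma}\Delta\to\operatorname{Spec} P$ is an isomorphism, where the fiber product is taken in the category of saturated monoschemes.
   Context: All monoids are commutative. A monoid $P$ is integral if $P\to P^{\mathrm{gp}}$ is injective; a valuative monoid is an integral monoid $P$ such that for every $a\in P^{\mathrm{gp}}$ either $a\in P$ or $-a\in P$ (such a monoid is automatically saturated). A monoscheme is a locally monoidal space that is locally isomorphic to $\operatorname{Spec} M$ for monoids $M$ (where $\operatorname{Spec} M$ is the set of prime ideals of $M$ with its Zariski topology and structure sheaf of monoids obtained by localization); it is saturated (resp. fs) if it is locally of the form $\operatorname{Spec} M$ with $M$ saturated (resp. fine and saturated). Fiber products exist in the category of saturated monoschemes and in general differ from those in the category of all monoschemes. A fan in a lattice $N$ is a finite collection of strongly convex rational polyhedral cones, closed under taking faces, any two of which intersect in a common face; its support $|\Sigma|$ is the union of its cones. A morphism of fans $\Delta\to\Sigma$ (in lattices $N$, $N'$) is a homomorphism of lattices $f\colon N\to N'$ such that for every $\sigma\in\Delta$ one has $f(\sigma)\subset\sigma'$ for some $\sigma'\in\Sigma$. It is a partial subdivision if the lattice homomorphism is an isomorphism, and a subdivision if moreover $|\Delta|=|\Sigma|$ (under this identification). A fan is regarded as a connected separated fs monoscheme by gluing the monoschemes $\operatorname{Spec}(\sigma^\vee\cap N^\vee)$ for its cones $\sigma$,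 and a morphism of fans as the induced morphism of monoschemes. *)

(* Defs.v *)
From HB Require Import structures.
From Stdlib Require Import Relation_Operators.
From mathcomp Require Import all_boot all_order all_algebra.
From mathcomp Require Import all_classical all_reals topology.
From mathcomp Require Import generic_quotient.

Set Implicit Arguments.
Unset Strict Implicit.
Unset Printing Implicit Defensive.

Import Order.TTheory GRing.Theory Num.Theory.
Local Open Scope classical_set_scope.
Local Open Scope ring_scope.

(** * Commutative monoids, written additively *)

Lemma additive_ext (U V : nmodType) (f g : {additive U -> V}) :
  f =1 g -> f = g.
Proof.
case: f => f [[df]]; case: g => g [[dg]] /= /funext efg.
by move: df dg; rewrite efg => df dg; rewrite (Prop_irrelevance df dg).
Qed.

Definition is_unit (M : nmodType) (a : M) := exists b, a + b = 0.

Lemma unit_inv_uniq (M : nmodType) (a b c : M) :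
  a + b = 0 -> a + c = 0 -> b = c.
Proof.
by move=> ab ac; rewrite -[b]addr0 -ac addrA [b + a]addrC ab add0r.
Qed.

Lemma is_unit_raddf (M M' : nmodType) (f : {additive M -> M'}) a :
  is_unit a -> is_unit (f a).
Proof. by case=> b ab; exists (f b); rewrite -raddfD ab raddf0. Qed.

Record submonoid (M : nmodType) := Submonoid {
  sm_set :> M -> Prop;
  sm0 : sm_set 0;
  smD : forall a b, sm_set a -> sm_set b -> sm_set (a + b) }.

Definition sm_pred (M : nmodType) (S : submonoid M) : pred M :=
  fun a => `[< S a >].

(* The underlying monoid of a submonoid. *)
Record sub_of (M : nmodType) (S : submonoid M) :=
  SubOf { sub_val : M; sub_valP : sm_pred S sub_val }.

HB.instance Definition _ (M : nmodType) (S : submonoid M) :=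
  [isSub for @sub_val M S].
HB.instance Definition _ (M : nmodType) (S : submonoid M) :=
  [Choice of sub_of S by <:].

Lemma sm_pred_closed (M : nmodType) (S : submonoid M) : GRing.nmod_closed (sm_pred S).
Proof.
split; first exact/asboolP/sm0.
by move=> a b /asboolP Sa /asboolP Sb; apply/asboolP/smD.
Qed.

HB.instance Definition _ (M : nmodType) (S : submonoid M) :=
  GRing.SubChoice_isSubNmodule.Build M (sm_pred S) (sub_of S)
    (sm_pred_closed S).

Definition mksub (M : nmodType) (S : submonoid M) (a : M) (Sa : S a) :
  sub_of S := SubOf (introT (asboolP _) Sa : sm_pred S a).

Lemma sub_valS (M : nmodType) (S : submonoid M) (a : sub_of S) : S (sub_val a).
Proof. exact/asboolP/(sub_valP a). Qed.

Lemma sub_valD (M : nmodType) (S : submonoid M) (a b : sub_of S) :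
  sub_val (a + b) = sub_val a + sub_val b.
Proof. by []. Qed.

HB.instance Definition _ (M : nmodType) (S : submonoid M) :=
  GRing.isNmodMorphism.Build (sub_of S) M (@sub_val M S)
    (conj erefl (@sub_valD M S)).

Section SubMap.
Variables (M M' : nmodType) (S : submonoid M) (S' : submonoid M').
Variables (f : {additive M -> M'}) (Sf : forall a, S a -> S' (f a)).

Definition sub_map_fun (a : sub_of S) : sub_of S' := mksub (Sf (sub_valS a)).

Lemma sub_map_additive : nmod_morphism sub_map_fun.
Proof.
by split=> [|a b]; apply: val_inj; rewrite /= ?raddf0 ?raddfD.
Qed.

HB.instance Definition _ :=
  GRing.isNmodMorphism.Build _ _ sub_map_fun sub_map_additive.

Definition sub_map : {additive sub_of S -> sub_of S'} := sub_map_fun.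

End SubMap.

(** ** Localization *)

Section Localization.
Variables (M : nmodType) (S : submonoid M).

(* A pair (a, s) stands for the formal difference a - s. *)
Definition fpair := (M * sub_of S)%type.

Definition frac_rel (x y : fpair) : bool :=
  `[< exists2 u, S u & u + x.1 + sub_val y.2 = u + y.1 + sub_val x.2 >].

Lemma frac_rel_refl : reflexive frac_rel.
Proof. by move=> x; apply/asboolP; exists 0 => //; exact: sm0. Qed.

Lemma frac_rel_sym : symmetric frac_rel.
Proof.
by move=> x y; apply/idP/idP => /asboolP[u Su e]; apply/asboolP; exists u.
Qed.

Lemma frac_rel_trans : transitive frac_rel.
Proof.
move=> y x z /asboolP[u Su e] /asboolP[v Sv e']; apply/asboolP.
exists (u + v + sub_val y.2); first by do 2?apply: smD => //; exact: sub_valS.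
transitivity (v + sub_val z.2 + (u + x.1 + sub_val y.2)).
  by rewrite [LHS](AC (3*1*1) ((2*5)*(1*4*3))).
rewrite e; transitivity (u + sub_val x.2 + (v + y.1 + sub_val z.2)).
  by rewrite [LHS](AC (2*3) ((3*5)*(1*4*2))).
by rewrite e' [LHS](AC (2*3) (1*3*5*4*2)).
Qed.

Canonical frac_equiv := EquivRel frac_rel
  frac_rel_refl frac_rel_sym frac_rel_trans.

Definition loc := {eq_quot frac_equiv}%qT.
HB.instance Definition _ := Choice.on loc.
HB.instance Definition _ := EqQuotient.on loc.

Definition fracs (x : fpair) : loc := \pi_loc%qT x.

Lemma fracsP x y :
  fracs x = fracs y <->
  exists2 u, S u & u + x.1 + sub_val y.2 = u + y.1 + sub_val x.2.
Proof.
by split=> [/eqP|e]; [rewrite eqmodE => /asboolP|apply/eqP; rewrite eqmodE; apply/asboolP].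
Qed.

Lemma fracs_surj (z : loc) : exists x, z = fracs x.
Proof. by exists (repr z); rewrite /fracs reprK. Qed.

Definition loc_add (z t : loc) : loc :=
  fracs ((repr z).1 + (repr t).1, (repr z).2 + (repr t).2).

Lemma fracsD x y : loc_add (fracs x) (fracs y) = fracs (x.1 + y.1, x.2 + y.2).
Proof.
have [u Su eu] : exists2 u, S u & u + (repr (fracs x)).1 + sub_val x.2 =
    u + x.1 + sub_val (repr (fracs x)).2 by apply/fracsP; rewrite /fracs reprK.
have [v Sv ev] : exists2 u, S u & u + (repr (fracs y)).1 + sub_val y.2 =
    u + y.1 + sub_val (repr (fracs y)).2 by apply/fracsP; rewrite /fracs reprK.
apply/fracsP => /=; exists (u + v); first exact: smD.
set a := repr (fracs x) in eu *; set b := repr (fracs y) in ev *.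
transitivity ((u + a.1 + sub_val x.2) + (v + b.1 + sub_val y.2)).
  by rewrite [LHS](AC (2*2*2) ((1*3*5)*(2*4*6))).
by rewrite eu ev [LHS](AC (3*3) ((1*4)*(2*5)*(3*6))).
Qed.

Lemma loc_addA : associative loc_add.
Proof.
move=> z t w; have [x ->] := fracs_surj z; have [y ->] := fracs_surj t.
by have [r ->] := fracs_surj w; rewrite !fracsD /= !addrA.
Qed.

Lemma loc_addC : commutative loc_add.
Proof. by move=> z t; rewrite /loc_add addrC [X in (_, X)]addrC. Qed.

Lemma loc_add0 : left_id (fracs (0, 0)) loc_add.
Proof.
by move=> z; have [[a s] ->] := fracs_surj z; rewrite fracsD /= !add0r.
Qed.

HB.instance Definition _ := GRing.isNmodule.Build loc
  loc_addA loc_addC loc_add0.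

Definition frac (a s : M) (Ss : S s) : loc := fracs (a, mksub Ss).

Lemma fracP a s (Ss : S s) b t (St : S t) :
  frac a Ss = frac b St <-> exists2 u, S u & u + a + t = u + b + s.
Proof. exact: fracsP. Qed.

Lemma fracD a s (Ss : S s) b t (St : S t) :
  frac a Ss + frac b St = frac (a + b) (smD Ss St).
Proof.
by rewrite [LHS]fracsD /=; congr (fracs (_, _)); apply: val_inj.
Qed.

Lemma frac0 : 0 = frac 0 (sm0 S).
Proof. by congr (fracs (_, _)); apply: val_inj. Qed.

Lemma frac_surj (z : loc) : exists a s (Ss : S s), z = frac a Ss.
Proof.
have [[a s] ->] := fracs_surj z; exists a, (sub_val s), (sub_valS s).
by congr (fracs (_, _)); apply: val_inj.
Qed.

End Localization.

Arguments frac {M} S a {s}.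

(** ** Groupification *)

Definition full_submonoid (M : nmodType) : submonoid M :=
  @Submonoid M (fun=> True) I (fun _ _ _ _ => I).

Definition gp (M : nmodType) := loc (full_submonoid M).

Section Groupification.
Variable M : nmodType.

HB.instance Definition _ := GRing.Nmodule.on (gp M).

Definition gp_opp (z : gp M) : gp M :=
  fracs ((sub_val (repr z).2, mksub (I : full_submonoid M (repr z).1))).

Lemma gp_addNr : left_inverse 0 gp_opp +%R.
Proof.
move=> z; rewrite /gp_opp -{3}[z]reprK; case: (repr z) => a s.
rewrite [LHS]fracsD; apply/fracsP; exists 0 => //=.
by rewrite !add0r addr0 addrC.
Qed.

HB.instance Definition _ := GRing.Nmodule_isZmodule.Build (gp M) gp_addNr.

Definition to_gp (a : M) : gp M := frac (full_submonoid M) a (sm0 (full_submonoid M)).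

End Groupification.

Definition integral (M : nmodType) := injective (@to_gp M).

Definition valuative (M : nmodType) :=
  integral M /\ forall z : gp M, range (@to_gp M) z \/ range (@to_gp M) (- z).

Definition saturated (M : nmodType) :=
  integral M /\ forall (z : gp M) (k : nat),
    (0 < k)%N -> range (@to_gp M) (z *+ k) -> range (@to_gp M) z.

Section LocMap.
Variables (M M' : nmodType) (S : submonoid M) (S' : submonoid M').
Variables (f : {additive M -> M'}) (Sf : forall a, S a -> S' (f a)).

Definition loc_map_fun (z : loc S) : loc S' :=
  fracs (f (repr z).1, sub_map Sf (repr z).2).

Lemma loc_map_fracs x :
  loc_map_fun (fracs x) = fracs (f x.1, sub_map Sf x.2).
Proof.
have [u Su eu] : exists2 u, S u & u + (repr (fracs x)).1 + sub_val x.2 =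
    u + x.1 + sub_val (repr (fracs x)).2 by apply/fracsP; rewrite /fracs reprK.
by apply/fracsP; exists (f u); [exact: Sf|rewrite /= -!raddfD eu].
Qed.

Lemma loc_map_additive : nmod_morphism loc_map_fun.
Proof.
split=> [|z t].
  by rewrite loc_map_fracs /= !raddf0.
have [x ->] := fracs_surj z; have [y ->] := fracs_surj t.
by rewrite [fracs x + _]fracsD !loc_map_fracs [RHS]fracsD /= !raddfD.
Qed.

HB.instance Definition _ :=
  GRing.isNmodMorphism.Build _ _ loc_map_fun loc_map_additive.

Definition loc_map : {additive loc S -> loc S'} := loc_map_fun.

Lemma loc_mapE a s (Ss : S s) (Sfs : S' (f s)) :
  loc_map (frac S a Ss) = frac S' (f a) Sfs.
Proof.
rewrite [LHS]loc_map_fracs; congr (fracs (_, _)); exact: val_inj.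
Qed.

End LocMap.

(** ** Products *)

Section Products.
Variables (I : Type) (F : I -> nmodType).

Definition dprod := forall i, F i.

HB.instance Definition _ := gen_eqMixin dprod.
HB.instance Definition _ := gen_choiceMixin dprod.

Let add (s t : dprod) : dprod := fun i => s i + t i.
Let addA : associative add.
Proof. by move=> s t u; apply: functional_extensionality_dep => i; exact: addrA. Qed.
Let addC : commutative add.
Proof. by move=> s t; apply: functional_extensionality_dep => i; exact: addrC. Qed.
Let add0 : left_id (fun i => 0) add.
Proof. by move=> s; apply: functional_extensionality_dep => i; exact: add0r. Qed.

HB.instance Definition _ := GRing.isNmodule.Build dprod addA addC add0.

Lemma dprodD (s t : dprod) i : (s + t) i = s i + t i. Proof. by []. Qed.
Lemma dprod0 i : (0 : dprod) i = 0. Proof. by []. Qed.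

End Products.

(** * Locally monoidal spaces *)

Record opens (X : topologicalType) := Opens {
  oset :> X -> Prop;
  oopen : open oset }.

Lemma opens_ext (X : topologicalType) (U V : opens X) :
  (forall x, U x <-> V x) -> U = V.
Proof.
case: U V => U oU [V oV] /= /predeqP UV; move: oU oV; rewrite UV => oU oV.
by rewrite (Prop_irrelevance oU oV).
Qed.

Definition opens_preim (X Y : topologicalType) (f : X -> Y) (cf : continuous f)
    (V : opens Y) : opens X :=
  Opens (open_comp (in1W cf) (oopen V) : open (fun x => V (f x))).

(* A topological space with a sheaf of monoids.  No locality condition is
   needed on the stalks, since a commutative monoid always has a unique
   maximal ideal, the set of non-units. *)
Record lms := Lms {
  pts :> topologicalType;
  sec : opens pts -> nmodType;
  res : forall U V : opens pts, V `<=` U -> {additive sec U -> sec V};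
  res_id : forall (U : opens pts) (h : U `<=` U) (s : sec U), res h s = s;
  res_comp : forall (U V W : opens pts) (h : V `<=` U) (k : W `<=` V)
    (l : W `<=` U) (s : sec U), res k (res h s) = res l s;
  sheafP : forall (I : Type) (U : opens pts) (V : I -> opens pts)
    (VU : forall i, V i `<=` U), U `<=` \bigcup_i (V i : set pts) ->
    forall s : forall i, sec (V i),
    (forall i j (W : opens pts) (Wi : W `<=` V i) (Wj : W `<=` V j),
       res Wi (s i) = res Wj (s j)) ->
    exists! t : sec U, forall i, res (VU i) t = s i }.

(* The germ of [s] at [x] is a unit of the stalk: the stalk is the filtered
   colimit of the [sec W] over the neighbourhoods [W] of [x], so this holds
   iff [s] becomes a unit on one of them. *)
Definition germ_unit (X : lms) (x : X) (U : opens X) (s : sec U) :=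
  exists (W : opens X) (h : W `<=` U), W x /\ is_unit (res h s).

(* [mlocal] says that the homomorphisms induced on stalks are local. *)
Record mor (X Y : lms) := Mor {
  mfun :> X -> Y;
  mcont : continuous mfun;
  pull : forall V : opens Y, {additive sec V -> sec (opens_preim mcont V)};
  pull_res : forall (V W : opens Y) (h : W `<=` V)
    (k : opens_preim mcont W `<=` opens_preim mcont V) (s : sec V),
    pull W (res h s) = res k (pull V s);
  mlocal : forall (x : X) (V : opens Y) (s : sec V), V (mfun x) ->
    germ_unit x (pull V s) -> germ_unit (mfun x) s }.

Arguments mcont {X Y} _.
Arguments pull {X Y} _ V.

Lemma res_irr (X : lms) (U V : opens X) (h k : V `<=` U) (s : sec U) :
  res h s = res k s.
Proof. by rewrite (Prop_irrelevance h k). Qed.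

Lemma sec_ext (X : lms) (I : Type) (U : opens X) (V : I -> opens X)
    (VU : forall i, V i `<=` U) (s t : sec U) :
  U `<=` \bigcup_i (V i : set X) ->
  (forall i, res (VU i) s = res (VU i) t) -> s = t.
Proof.
move=> cov st.
have [|r [_ ru]] := sheafP VU cov (s := fun i => res (VU i) t).
  move=> i j W Wi Wj; have WU := subset_trans Wi (VU i).
  by rewrite (res_comp _ _ WU) (res_comp _ _ WU).
by rewrite -(ru s) // -(ru t).
Qed.

Lemma mor_ext (X Y : lms) (f g : mor X Y) :
  (forall x, f x = g x) ->
  (forall (V : opens Y) (s : sec V) (W : opens X)
     (h : W `<=` opens_preim (mcont f) V) (k : W `<=` opens_preim (mcont g) V),
     res h (pull f V s) = res k (pull g V s)) ->
  f = g.
Proof.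
case: f => f cf pf rf lf; case: g => g cg pg rg lg /= /funext efg.
move: cg pg rg lg; rewrite -efg => cg; rewrite (Prop_irrelevance cg cf).
move=> pg rg lg e.
have epg : pf = pg.
  apply: functional_extensionality_dep => V; apply: additive_ext => s.
  have h : opens_preim cf V `<=` opens_preim cf V by [].
  by have := e V s _ h h; rewrite !res_id.
move: rg lg; rewrite -epg => rg lg.
by rewrite (Prop_irrelevance rg rf) (Prop_irrelevance lg lf).
Qed.

Lemma mor_eq_pull (X Y : lms) (f g : mor X Y) : f = g ->
  forall (V : opens Y) (s : sec V) (W : opens X)
    (h : W `<=` opens_preim (mcont f) V) (k : W `<=` opens_preim (mcont g) V),
  res h (pull f V s) = res k (pull g V s).
Proof. by move=> -> V s W h k; exact: res_irr. Qed.

Section Identity.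
Variable X : lms.

Let cont : continuous (idfun : X -> X). Proof. by move=> x; exact: cvg_id. Qed.

Definition id_pull (V : opens X) : {additive sec V -> sec (opens_preim cont V)} :=
  res (@subset_refl _ V : opens_preim cont V `<=` V).

Let nat (V W : opens X) (h : W `<=` V)
    (k : opens_preim cont W `<=` opens_preim cont V) (s : sec V) :
  id_pull W (res h s) = res k (id_pull V s).
Proof.
have l : opens_preim cont W `<=` V by move=> x; exact: h.
by rewrite /id_pull !(res_comp _ _ l).
Qed.

Let local (x : X) (V : opens X) (s : sec V) : V x ->
  germ_unit x (id_pull V s) -> germ_unit x s.
Proof.
move=> _ [W [h [Wx]]]; rewrite (res_comp _ _ (h : W `<=` V)) => sW.
by exists W, h.
Qed.

Definition mor_id : mor X X := Mor nat local.

End Identity.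

Section Composition.
Variables (X Y Z : lms) (g : mor Y Z) (f : mor X Y).

Let cont : continuous (g \o f).
Proof. by move=> x; apply: continuous_comp; exact: mcont. Qed.

Definition comp_pull (V : opens Z) : {additive sec V -> sec (opens_preim cont V)} :=
  res (@subset_refl _ _ :
      opens_preim cont V `<=` opens_preim (mcont f) (opens_preim (mcont g) V))
  \o (pull f (opens_preim (mcont g) V) \o pull g V).

Let nat (V W : opens Z) (h : W `<=` V)
    (k : opens_preim cont W `<=` opens_preim cont V) (s : sec V) :
  comp_pull W (res h s) = res k (comp_pull V s).
Proof.
have k1 : opens_preim (mcont g) W `<=` opens_preim (mcont g) V.
  by move=> y; exact: h.
have k2 : opens_preim (mcont f) (opens_preim (mcont g) W) `<=`
  opens_preim (mcont f) (opens_preim (mcont g) V) by move=> x; exact: h.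
have k3 : opens_preim cont W `<=`
  opens_preim (mcont f) (opens_preim (mcont g) V) by move=> x; exact: h.
rewrite /comp_pull /= (pull_res _ k1) (pull_res _ k2).
by rewrite [LHS](res_comp _ _ k3) [RHS](res_comp _ _ k3).
Qed.

Let local (x : X) (V : opens Z) (s : sec V) : V (g (f x)) ->
  germ_unit x (comp_pull V s) -> germ_unit (g (f x)) s.
Proof.
move=> Vx [W [h [Wx]]] sW; apply: (@mlocal _ _ g (f x)) => //.
apply: (@mlocal _ _ f) => //; exists W.
have h' : W `<=` opens_preim (mcont f) (opens_preim (mcont g) V) by [].
pose r : opens_preim cont V `<=`
  opens_preim (mcont f) (opens_preim (mcont g) V) := @subset_refl _ _.
by exists h'; split; rewrite // -(res_comp r h h').
Qed.

Definition mor_comp : mor X Z := Mor nat local.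

End Composition.

Definition is_iso (X Y : lms) (f : mor X Y) :=
  exists g : mor Y X, mor_comp g f = mor_id X /\ mor_comp f g = mor_id Y.

Lemma germ_unit_res (X : lms) (x : X) (U V : opens X) (h : V `<=` U)
  (s : sec U) : V x -> germ_unit x (res h s) <-> germ_unit x s.
Proof.
move=> Vx; split=> [[W [k [Wx]]]|[W [k [Wx sW]]]].
  rewrite (res_comp _ _ (subset_trans k h)) => sW.
  by exists W, (subset_trans k h).
pose Z := Opens (openI (oopen V) (oopen W) : open (fun y => V y /\ W y)).
have ZV : Z `<=` V by move=> y [].
have ZW : Z `<=` W by move=> y [].
exists Z, ZV; split => //.
rewrite (res_comp _ _ (subset_trans ZW k)) -(res_comp k ZW).
exact: is_unit_raddf.
Qed.

Lemma germ_unit_pull (X Y : lms) (f : mor X Y) (x : X) (V : opens Y)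
  (s : sec V) : germ_unit (f x) s -> germ_unit x (pull f V s).
Proof.
move=> [W [h [Wx sW]]].
have k : opens_preim (mcont f) W `<=` opens_preim (mcont f) V.
  by move=> y; exact: h.
exists (opens_preim (mcont f) W), k; split => //.
by rewrite -(pull_res h); exact: is_unit_raddf.
Qed.

Lemma germ_unit_near (X : lms) (x : X) (U : opens X) (s : sec U) :
  germ_unit x s ->
  exists W : opens X, [/\ W `<=` U, W x & forall y, W y -> germ_unit y s].
Proof.
by move=> [W [h [Wx sW]]]; exists W; split=> // y Wy; exists W, h.
Qed.

Lemma germ_unit_all (X : lms) (U : opens X) (s : sec U) :
  (forall x, U x -> germ_unit x s) -> is_unit s.
Proof.
move=> us.
pose V (x : {x | U x}) := sval (cid (us _ (proj2_sig x))).
have VP x : exists h : V x `<=` U, V x (sval x) /\ is_unit (res h s).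
  exact: proj2_sig (cid (us _ (proj2_sig x))).
have VU x : V x `<=` U by have [] := VP x.
have cov : U `<=` \bigcup_x (V x : set X).
  by move=> x Ux; exists (exist _ x Ux) => //; have [h []] := VP (exist _ x Ux).
have inv x : {t | res (VU x) s + t = 0}.
  by apply: cid; have [h [_]] := VP x; rewrite (res_irr h (VU x)).
have [|t [tP _]] := sheafP VU cov (s := fun x => sval (inv x)).
  move=> x y W Wx Wy; have WU := subset_trans Wx (VU x).
  apply: (@unit_inv_uniq _ (res WU s)).
    by rewrite -(res_comp (VU x) Wx) -raddfD (proj2_sig (inv x)) raddf0.
  by rewrite -(res_comp (VU y) Wy) -raddfD (proj2_sig (inv y)) raddf0.
exists t; apply: (sec_ext (VU := VU)) => // x.
by rewrite raddfD tP raddf0; exact: proj2_sig (inv x).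
Qed.

(** * Spectra *)

Definition prime_ideal (M : nmodType) (p : M -> Prop) :=
  [/\ forall a b, p a -> p (a + b), ~ p 0 &
      forall a b, p (a + b) -> p a \/ p b].

Record spec_pts (M : nmodType) := SpecPt {
  pideal :> M -> Prop;
  pprime : prime_ideal pideal }.

Section Zariski.
Variable M : nmodType.
Implicit Types p q : spec_pts M.

Lemma spec_pts_ext p q : (forall a, p a <-> q a) -> p = q.
Proof.
case: p q => p pp [q qq] /= /predeqP pq; move: pp qq; rewrite pq => pp qq.
by rewrite (Prop_irrelevance pp qq).
Qed.

Lemma compl0 p : ~ p 0. Proof. by case: (pprime p). Qed.

Lemma complD p a b : ~ p a -> ~ p b -> ~ p (a + b).
Proof. by case: (pprime p) => _ _ pD pa pb /pD[]. Qed.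

Lemma complDl p a b : ~ p (a + b) -> ~ p a.
Proof. by case: (pprime p) => pD _ _ pab /(pD _ b). Qed.

Definition compl p : submonoid M := Submonoid (@compl0 p) (@complD p).

HB.instance Definition _ := gen_eqMixin (spec_pts M).
HB.instance Definition _ := gen_choiceMixin (spec_pts M).

(* The sets D(a) = {p | a is not in p} form a basis of the topology. *)
Definition zariski : set_system (spec_pts M) :=
  [set U | forall p, U p -> exists2 a, ~ p a & [set q | ~ (q : spec_pts M) a] `<=` U].

Let zariskiT : zariski setT.
Proof. by move=> p _; exists 0 => //; exact: compl0. Qed.

Let zariskiI : setI_closed zariski.
Proof.
move=> U V oU oV p [/oU[a pa aU] /oV[b pb bV]]; exists (a + b).
  exact: complD.
move=> q /= qab; split; [apply: aU|apply: bV]; move=> /=.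
  exact: complDl qab.
by apply: (@complDl _ _ a); rewrite addrC.
Qed.

Let zariskiU (I : Type) (f : I -> set (spec_pts M)) :
  (forall i, zariski (f i)) -> zariski (\bigcup_i f i).
Proof.
move=> of_ p [i _ /(of_ i)[a pa aU]]; exists a => //.
by move=> q /aU; exists i.
Qed.

HB.instance Definition _ :=
  isOpenTopological.Build (spec_pts M) zariskiT zariskiI zariskiU.

Lemma spec_openE (U : set (spec_pts M)) : open U = zariski U.
Proof. by []. Qed.

(* The sections over U are the families of elements of the localizations
   M_p for p in U which are locally of the form a - b. *)
Definition stalks (U : opens (spec_pts M)) : nmodType :=
  dprod (fun p : {p | U p} => loc (compl (sval p))).

Definition locally_frac (U : opens (spec_pts M)) (s : stalks U) :=
  forall p, U p -> exists (W : set (spec_pts M)) (a b : M),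
    [/\ open W, W p & forall q (Uq : U q), W q ->
        exists qb : compl q b, s (exist _ q Uq) = frac (compl q) a qb].

Lemma locally_frac0 (U : opens (spec_pts M)) : locally_frac (0 : stalks U).
Proof.
move=> p Up; exists setT, 0, 0; split; [exact: openT|by []|].
by move=> q Uq _; exists (@compl0 q); rewrite dprod0 [LHS]frac0.
Qed.

Lemma locally_fracD (U : opens (spec_pts M)) (s t : stalks U) :
  locally_frac s -> locally_frac t -> locally_frac (s + t).
Proof.
move=> ls lt p Up; have [W [a [b [oW Wp es]]]] := ls p Up.
have [W' [a' [b' [oW' Wp' et]]]] := lt p Up.
exists (W `&` W'), (a + a'), (b + b'); split; [exact: openI|by split|].
move=> q Uq [/(es q Uq)[qb eq] /(et q Uq)[qb' eq']].
by exists (complD qb qb'); rewrite dprodD eq eq' fracD.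
Qed.

Definition spec_sec (U : opens (spec_pts M)) : submonoid (stalks U) :=
  Submonoid (@locally_frac0 U) (@locally_fracD U).

Section Restriction.
Variables (U V : opens (spec_pts M)) (h : V `<=` U).

Definition stalks_res (s : stalks U) : stalks V :=
  fun x => s (exist _ (sval x) (h (proj2_sig x))).

Lemma stalks_res_additive : nmod_morphism stalks_res. Proof. by []. Qed.

HB.instance Definition _ :=
  GRing.isNmodMorphism.Build _ _ stalks_res stalks_res_additive.

Lemma locally_frac_res s : locally_frac s -> locally_frac (stalks_res s).
Proof.
move=> ls p Vp; have [W [a [b [oW Wp es]]]] := ls p (h Vp).
exists W, a, b; split; [exact: oW|exact: Wp|move=> q Vq Wq].
by have [qb e] := es q (h Vq) Wq; exists qb; exact: e.
Qed.

Definition spec_res : {additive sub_of (spec_sec U) -> sub_of (spec_sec V)} :=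
  @sub_map _ _ (spec_sec U) (spec_sec V) stalks_res locally_frac_res.

End Restriction.

Lemma spec_res_id (U : opens (spec_pts M)) (h : U `<=` U)
  (s : sub_of (spec_sec U)) : spec_res h s = s.
Proof.
apply: val_inj; apply: functional_extensionality_dep => -[p Up] /=.
by rewrite /stalks_res /= (Prop_irrelevance (h p Up) Up).
Qed.

Lemma spec_res_comp (U V W : opens (spec_pts M)) (h : V `<=` U) (k : W `<=` V)
  (l : W `<=` U) (s : sub_of (spec_sec U)) :
  spec_res k (spec_res h s) = spec_res l s.
Proof.
apply: val_inj; apply: functional_extensionality_dep => -[p Up] /=.
rewrite /stalks_res /=; congr (sub_val s (exist _ p _)).
exact: Prop_irrelevance.
Qed.

Lemma spec_sheafP (I : Type) (U : opens (spec_pts M))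
    (V : I -> opens (spec_pts M)) (VU : forall i, V i `<=` U) :
  U `<=` \bigcup_i (V i : set (spec_pts M)) ->
  forall s : forall i, sub_of (spec_sec (V i)),
  (forall i j (W : opens (spec_pts M)) (Wi : W `<=` V i) (Wj : W `<=` V j),
     spec_res Wi (s i) = spec_res Wj (s j)) ->
  exists! t : sub_of (spec_sec U), forall i, spec_res (VU i) t = s i.
Proof.
move=> cov s comp.
have ch (x : {p | U p}) : {i | V i (sval x)}.
  by apply: cid; have [i _ Vix] := cov _ (proj2_sig x); exists i.
have agree i j p (Vi : V i p) (Vj : V j p) :
    sub_val (s i) (exist _ p Vi) = sub_val (s j) (exist _ p Vj).
  pose W := Opens (openI (oopen (V i)) (oopen (V j)) : open (fun q => V i q /\ V j q)).
  have Wi : W `<=` V i by move=> q [].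
  have Wj : W `<=` V j by move=> q [].
  pose ev (r : sub_of (spec_sec W)) := sub_val r (exist W p (conj Vi Vj)).
  have := congr1 ev (comp i j W Wi Wj); rewrite /ev /= /stalks_res /=.
  by rewrite (Prop_irrelevance (Wi _ _) Vi) (Prop_irrelevance (Wj _ _) Vj).
pose t : stalks U :=
  fun x => sub_val (s (sval (ch x))) (exist _ (sval x) (proj2_sig (ch x))).
have lt : spec_sec U t.
  move=> p Up; have [i _ Vip] := cov _ Up.
  have [W [a [b [oW Wp es]]]] := sub_valS (s i) p Vip.
  exists (W `&` V i), a, b; split => //; first by apply: openI => //; exact: oopen.
  move=> q Uq [Wq Viq]; have [qb e] := es q Viq Wq.
  by exists qb; rewrite -e; exact: agree.
exists (mksub lt); split=> [i|r er].
  apply: val_inj; apply: functional_extensionality_dep => -[p Vp] /=.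
  exact: agree.
apply: val_inj; apply: functional_extensionality_dep => -[p Up] /=.
rewrite /t /= -(er (sval (ch (exist _ p Up)))) /= /stalks_res /=.
by congr (sub_val r (exist _ p _)); exact: Prop_irrelevance.
Qed.

Definition spec : lms := Lms spec_res_id spec_res_comp spec_sheafP.

End Zariski.

Section SpecMap.
Variables (M M' : nmodType) (f : {additive M -> M'}).

Lemma preim_prime (q : spec_pts M') : prime_ideal (fun a => q (f a)).
Proof.
case: (pprime q) => qD q0 qpr; split=> [a b||a b].
- by rewrite raddfD; exact: qD.
- by rewrite raddf0.
- by rewrite raddfD; exact: qpr.
Qed.

Definition spec_fun (q : spec M') : spec M := SpecPt (preim_prime q).

Lemma spec_fun_continuous : continuous spec_fun.
Proof.
apply/continuousP => U; rewrite !spec_openE => oU q /oU[a qa aU].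
by exists (f a) => // r rfa; exact: aU.
Qed.

Let cont := spec_fun_continuous.

Definition spec_stalk_map (q : spec_pts M') :
    {additive loc (compl (spec_fun q)) -> loc (compl q)} :=
  @loc_map _ _ (compl (spec_fun q)) (compl q) f (fun a qa => qa).

Lemma spec_stalk_mapE q a b (qb : compl (spec_fun q) b) :
  spec_stalk_map q (frac (compl (spec_fun q)) a qb) =
  @frac _ (compl q) (f a) (f b) qb.
Proof. exact: loc_mapE. Qed.

Section Pull.
Variable V : opens (spec M).

Definition stalks_pull (s : stalks V) : stalks (opens_preim cont V) :=
  fun x => spec_stalk_map (sval x) (s (exist _ (spec_fun (sval x)) (proj2_sig x))).

Lemma stalks_pull_additive : nmod_morphism stalks_pull.
Proof.
split=> [|s t]; apply: functional_extensionality_dep => x.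
  by rewrite /stalks_pull dprod0 raddf0.
by rewrite /stalks_pull !dprodD raddfD.
Qed.

HB.instance Definition _ :=
  GRing.isNmodMorphism.Build _ _ stalks_pull stalks_pull_additive.

Lemma locally_frac_pull s : locally_frac s -> locally_frac (stalks_pull s).
Proof.
move=> ls q Vq; have [W [a [b [oW Wp es]]]] := ls (spec_fun q) Vq.
exists (spec_fun @^-1` W), (f a), (f b); split; last 1 first.
- move=> r Vr Wr; have [rb e] := es (spec_fun r) Vr Wr.
  by exists rb; rewrite /stalks_pull /= e spec_stalk_mapE.
- by have /continuousP := cont; apply.
- exact: Wp.
Qed.

Definition spec_pull : {additive sec V -> sec (opens_preim cont V)} :=
  @sub_map _ _ (spec_sec V) (spec_sec (opens_preim cont V))
    stalks_pull locally_frac_pull.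

End Pull.

Lemma spec_pull_res (V W : opens (spec M)) (h : W `<=` V)
    (k : opens_preim cont W `<=` opens_preim cont V) (s : sec V) :
  spec_pull W (res h s) = res k (spec_pull V s).
Proof.
apply: val_inj; apply: functional_extensionality_dep => -[q Wq] /=.
rewrite /stalks_pull /stalks_res /=.
by rewrite (Prop_irrelevance (k q Wq) (h (spec_fun q) Wq)).
Qed.

Lemma frac_unit (N : nmodType) (p : spec_pts N) (a b : N) (pb : compl p b) :
  is_unit (frac (compl p) a pb) -> ~ p a.
Proof.
case=> z; have [c [d [pd ->]]] := frac_surj z.
rewrite fracD [RHS]frac0 => /fracP[u pu]; rewrite !addr0 => e pa.
suff : compl p (u + (b + d)).
  by rewrite -e; case: (pprime p) => pD _ _; apply; rewrite addrCA; exact: pD.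
by do 2?apply: complD.
Qed.

Lemma spec_local (q : spec M') (V : opens (spec M)) (s : sec V) :
  V (spec_fun q) -> germ_unit q (spec_pull V s) -> germ_unit (spec_fun q) s.
Proof.
move=> Vq [W [h [Wq [t st]]]].
have [W' [a [b [oW' W'q es]]]] := sub_valS s (spec_fun q) Vq.
have fqa : ~ q (f a).
  have [qb e] := es _ Vq W'q.
  pose ev (r : sec W) := sub_val r (exist W q Wq).
  have := congr1 ev st; rewrite /ev /= /stalks_res /stalks_pull /= => u.
  have : is_unit (spec_stalk_map q (frac (compl (spec_fun q)) a qb)).
    exists (ev t); rewrite -e; move: u; rewrite dprodD /=.
    by rewrite (Prop_irrelevance (h _ _) Vq).
  by rewrite spec_stalk_mapE => /frac_unit.
have oD : open (fun r : spec_pts M => [/\ V r, W' r & ~ r a]).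
  move=> r [/(oopen V)[c rc cV] /oW'[d rd dW] ra]; exists (c + d + a).
    by do 2?apply: complD.
  move=> r' /= r'cda; have r'cd := complDl r'cda; split.
  - exact/cV/complDl/r'cd.
  - by apply: dW => /=; rewrite addrC in r'cd; exact: complDl r'cd.
  - by rewrite addrC in r'cda; exact: complDl r'cda.
pose D := Opens oD.
have DV : D `<=` V by move=> r [].
have Da (r : spec_pts M) : D r -> compl r a by case.
pose t' : stalks D := fun x => frac (compl (sval x)) b (Da _ (proj2_sig x)).
have lt' : spec_sec D t'.
  move=> r Dr; exists setT, b, a; split; [exact: openT|by []|].
  by move=> r' Dr' _; exists (Da _ Dr').
exists D, DV; split => //; exists (mksub lt').
apply: val_inj; apply: functional_extensionality_dep => -[r Dr] /=.
rewrite dprodD /= /stalks_res /t' /=.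
have [_ W'r _] := Dr; have [rb ->] := es r (DV r Dr) W'r.
rewrite fracD dprod0 [RHS]frac0; apply/fracP; exists 0; first exact: compl0.
by rewrite !addr0 !add0r addrC.
Qed.

Definition spec_map : mor (spec M') (spec M) := Mor spec_pull_res spec_local.

End SpecMap.

Lemma pull_comp (X Y Z : lms) (g : mor Y Z) (f : mor X Y) (V : opens Z)
    (s : sec V) (W : opens X)
    (h : W `<=` opens_preim (mcont (mor_comp g f)) V)
    (k : W `<=` opens_preim (mcont f) (opens_preim (mcont g) V)) :
  res h (pull (mor_comp g f) V s) =
  res k (pull f (opens_preim (mcont g) V) (pull g V s)).
Proof. exact: res_comp. Qed.

Lemma mor_compA (X Y Z T : lms) (h : mor Z T) (g : mor Y Z) (f : mor X Y) :
  mor_comp h (mor_comp g f) = mor_comp (mor_comp h g) f.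
Proof.
apply: mor_ext => // V s W hW kW.
pose Vh := opens_preim (mcont h) V.
have l1 : W `<=` opens_preim (mcont (mor_comp g f)) Vh by [].
have l2 : W `<=` opens_preim (mcont f) (opens_preim (mcont g) Vh) by [].
rewrite (pull_comp _ hW l1) (pull_comp _ l1 l2).
have l3 : W `<=` opens_preim (mcont f) (opens_preim (mcont (mor_comp h g)) V).
  by [].
rewrite (pull_comp _ kW l3).
have k1 : opens_preim (mcont (mor_comp h g)) V `<=` opens_preim (mcont g) Vh.
  by [].
have k2 : opens_preim (mcont f) (opens_preim (mcont (mor_comp h g)) V) `<=`
  opens_preim (mcont f) (opens_preim (mcont g) Vh) by [].
rewrite -(res_id (@subset_refl _ _) (pull (mor_comp h g) V s)).
by rewrite (pull_comp _ _ k1) (pull_res _ k2) (res_comp _ _ l2).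
Qed.

Section SpecFunctor.
Variables (M N K : nmodType) (f : {additive M -> N}) (g : {additive N -> K}).

Lemma sec_stalk_eq (P Q : nmodType) (V : opens (spec_pts P)) (q : spec_pts Q)
    (s : stalks V) (e : {additive P -> Q}) (x y : spec_pts P)
    (ex : forall a, compl x a -> compl q (e a))
    (ey : forall a, compl y a -> compl q (e a)) (Vx : V x) (Vy : V y) :
  x = y ->
  loc_map ex (s (exist _ x Vx)) = loc_map ey (s (exist _ y Vy)).
Proof.
move=> xy; move: ey Vy; rewrite -xy => ey Vy.
by rewrite (Prop_irrelevance ey ex) (Prop_irrelevance Vy Vx).
Qed.

Lemma spec_map_comp (e : {additive M -> K}) : (forall a, e a = g (f a)) ->
  mor_comp (spec_map f) (spec_map g) = spec_map e.
Proof.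
move=> efg; apply: mor_ext => [q|V s W h k].
  by apply: spec_pts_ext => a /=; rewrite efg.
have l : W `<=`
    opens_preim (mcont (spec_map g)) (opens_preim (mcont (spec_map f)) V) := h.
rewrite (pull_comp _ h l).
apply: val_inj; apply: functional_extensionality_dep => -[q Wq] /=.
rewrite /stalks_res /= /stalks_pull /= /spec_stalk_map.
have xy : spec_fun f (spec_fun g q) = spec_fun e q.
  by apply: spec_pts_ext => a /=; rewrite efg.
have ex a : compl (spec_fun f (spec_fun g q)) a -> compl q (e a) by rewrite efg.
have Vx : V (spec_fun f (spec_fun g q)) := l q Wq.
rewrite -(sec_stalk_eq (sub_val s) ex _ Vx _ xy) (Prop_irrelevance (l q Wq) Vx).
have [a [b [xb ->]]] := frac_surj (sub_val s (exist _ _ Vx)).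
rewrite (loc_mapE _ _ _ (xb : compl (spec_fun g q) (f b))).
rewrite (loc_mapE _ _ _ (xb : compl q (g (f b)))) (loc_mapE _ _ _ (ex _ xb)).
by apply/fracP; exists 0; rewrite ?efg //; exact: compl0.
Qed.

End SpecFunctor.


(** * Gluing *)

(* The colimit of a diagram of locally monoidal spaces.  It carries the
   quotient topology and the limit sheaf, and its universal property is given
   by [glue_inj], [glue_inj_mp], [glue_desc] and [glue_desc_inj]. *)

Record diagram := Diagram {
  ix : Type;
  ob : ix -> lms;
  ar : ix -> ix -> Type;
  mp : forall i j, ar i j -> mor (ob i) (ob j) }.

Arguments ar : clear implicits.

Section Gluing.
Variable D : diagram.

Record glue_sum := GluePt { gix : ix D; gpt : ob gix }.

HB.instance Definition _ := gen_eqMixin glue_sum.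
HB.instance Definition _ := gen_choiceMixin glue_sum.

Inductive glue_step : glue_sum -> glue_sum -> Prop :=
  GlueStep i j (a : ar D i j) (p : ob i) :
    glue_step (GluePt p) (GluePt (mp a p)).

Definition glue_rel (x y : glue_sum) : bool :=
  `[< clos_refl_sym_trans _ glue_step x y >].

Lemma glue_rel_refl : reflexive glue_rel.
Proof. by move=> x; apply/asboolP; exact: rst_refl. Qed.

Lemma glue_rel_sym : symmetric glue_rel.
Proof.
by move=> x y; apply/idP/idP => /asboolP xy; apply/asboolP;
  exact: rst_sym.
Qed.

Lemma glue_rel_trans : transitive glue_rel.
Proof.
move=> y x z /asboolP xy /asboolP yz; apply/asboolP.
exact: rst_trans yz.
Qed.

Canonical glue_equiv := EquivRel glue_rel
  glue_rel_refl glue_rel_sym glue_rel_trans.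

Definition glue_pts := {eq_quot glue_equiv}%qT.
HB.instance Definition _ := Choice.on glue_pts.
HB.instance Definition _ := EqQuotient.on glue_pts.

Definition glue_in (i : ix D) (p : ob i) : glue_pts := \pi_glue_pts%qT (GluePt p).

Lemma glue_in_surj (x : glue_pts) : exists i (p : ob i), x = glue_in p.
Proof.
rewrite -[x]reprK; case: (repr x) => i p; by exists i, p.
Qed.

Lemma glue_in_mp i j (a : ar D i j) (p : ob i) : glue_in (mp a p) = glue_in p.
Proof.
apply/esym/eqP; rewrite eqmodE; apply/asboolP.
exact/rst_step/GlueStep.
Qed.

(* The quotient topology. *)
Definition glue_open : set_system glue_pts :=
  [set U | forall i, open (@glue_in i @^-1` U)].

Let glue_openT : glue_open setT.
Proof. by move=> i; rewrite preimage_setT; exact: openT. Qed.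

Let glue_openI : setI_closed glue_open.
Proof. by move=> U V oU oV i; rewrite preimage_setI; exact: openI. Qed.

Let glue_openU (I : Type) (f : I -> set glue_pts) :
  (forall i, glue_open (f i)) -> glue_open (\bigcup_i f i).
Proof.
by move=> of_ i; rewrite preimage_bigcup; apply: bigcup_open => k _; exact: of_.
Qed.

HB.instance Definition _ :=
  isOpenTopological.Build glue_pts glue_openT glue_openI glue_openU.

Lemma glue_openE (U : set glue_pts) : open U = glue_open U.
Proof. by []. Qed.

Lemma glue_in_continuous i : continuous (@glue_in i).
Proof. by apply/continuousP => U; rewrite glue_openE; exact. Qed.

Definition gpre (U : opens glue_pts) i : opens (ob i) :=
  opens_preim (@glue_in_continuous i) U.

(* The sections over U are the families of sections over the preimages of U
   which are compatible with the morphisms of the diagram. *)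
Definition glue_fam (U : opens glue_pts) : nmodType := dprod (fun i => sec (gpre U i)).

Definition glue_compat (U : opens glue_pts) (s : glue_fam U) :=
  forall i j (a : ar D i j)
    (h : gpre U i `<=` opens_preim (mcont (mp a)) (gpre U j)),
    res h (pull (mp a) (gpre U j) (s j)) = s i.

Lemma glue_compat0 (U : opens glue_pts) : glue_compat (0 : glue_fam U).
Proof. by move=> i j a h; rewrite dprod0 !raddf0. Qed.

Lemma glue_compatD (U : opens glue_pts) (s t : glue_fam U) :
  glue_compat s -> glue_compat t -> glue_compat (s + t).
Proof. by move=> cs ct i j a h; rewrite !dprodD !raddfD cs ct. Qed.

Definition glue_sec (U : opens glue_pts) : submonoid (glue_fam U) :=
  Submonoid (@glue_compat0 U) (@glue_compatD U).

Lemma gpreS (U V : opens glue_pts) (h : V `<=` U) i : gpre V i `<=` gpre U i.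
Proof. by move=> p; exact: h. Qed.

Lemma gpre_mp (U : opens glue_pts) i j (a : ar D i j) :
  gpre U i `<=` opens_preim (mcont (mp a)) (gpre U j).
Proof. by move=> p; rewrite /= glue_in_mp. Qed.

Arguments gpreS {U V} h i _ _.
Arguments gpre_mp {U i j} a _ _.

Section Restriction.
Variables (U V : opens glue_pts) (h : V `<=` U).

Definition glue_fam_res (s : glue_fam U) : glue_fam V :=
  fun i => res (gpreS h i) (s i).

Lemma glue_fam_res_additive : nmod_morphism glue_fam_res.
Proof.
by split=> [|s t]; apply: functional_extensionality_dep => i;
  rewrite /glue_fam_res ?dprodD ?dprod0 ?raddf0 ?raddfD.
Qed.

HB.instance Definition _ :=
  GRing.isNmodMorphism.Build _ _ glue_fam_res glue_fam_res_additive.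

Lemma glue_compat_res s : glue_compat s -> glue_compat (glue_fam_res s).
Proof.
move=> cs i j a k; rewrite /glue_fam_res -(cs i j a (gpre_mp a)).
have k' : opens_preim (mcont (mp a)) (gpre V j) `<=`
  opens_preim (mcont (mp a)) (gpre U j) by move=> p; exact: h.
have l : gpre V i `<=` opens_preim (mcont (mp a)) (gpre U j).
  by move=> p /k /k'.
by rewrite (pull_res _ k') !(res_comp _ _ l).
Qed.

Definition glue_res : {additive sub_of (glue_sec U) -> sub_of (glue_sec V)} :=
  @sub_map _ _ (glue_sec U) (glue_sec V) glue_fam_res glue_compat_res.

End Restriction.

Lemma glue_res_id (U : opens glue_pts) (h : U `<=` U)
  (s : sub_of (glue_sec U)) : glue_res h s = s.
Proof.
by apply: val_inj; apply: functional_extensionality_dep => i; exact: res_id.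
Qed.

Lemma glue_res_comp (U V W : opens glue_pts) (h : V `<=` U) (k : W `<=` V)
  (l : W `<=` U) (s : sub_of (glue_sec U)) :
  glue_res k (glue_res h s) = glue_res l s.
Proof.
by apply: val_inj; apply: functional_extensionality_dep => i; exact: res_comp.
Qed.

Lemma glue_sheafP (I : Type) (U : opens glue_pts)
    (V : I -> opens glue_pts) (VU : forall i, V i `<=` U) :
  U `<=` \bigcup_i (V i : set glue_pts) ->
  forall s : forall i, sub_of (glue_sec (V i)),
  (forall i j (W : opens glue_pts) (Wi : W `<=` V i) (Wj : W `<=` V j),
     glue_res Wi (s i) = glue_res Wj (s j)) ->
  exists! t : sub_of (glue_sec U), forall i, glue_res (VU i) t = s i.
Proof.
move=> cov s comp.
have covi i : gpre U i `<=` \bigcup_k (gpre (V k) i : set (ob i)).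
  by move=> p Up; have [k _ Vk] := cov (glue_in p) Up; exists k.
have VUi i k : gpre (V k) i `<=` gpre U i by exact: gpreS (VU k) i.
have sol i : {ti : sec (gpre U i) |
    (forall k, res (VUi i k) ti = sub_val (s k) i) /\
    (forall r, (forall k, res (VUi i k) r = sub_val (s k) i) -> ti = r)}.
  apply: cid; have [|ti [h1 h2]] := sheafP (VUi i) (covi i) (s := fun k => sub_val (s k) i).
    move=> k l W Wk Wl.
    pose Z := Opens (openI (oopen (V k)) (oopen (V l)) :
      open (fun x => V k x /\ V l x)).
    have Zk : Z `<=` V k by move=> x [].
    have Zl : Z `<=` V l by move=> x [].
    have WZ : W `<=` gpre Z i by move=> p Wp; split; [exact: Wk|exact: Wl].
    have := congr1 (fun r : sub_of (glue_sec Z) => res WZ (sub_val r i)) (comp k l Z Zk Zl).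
    by rewrite /= /glue_fam_res (res_comp _ _ Wk) (res_comp _ _ Wl).
  by exists ti.
pose t : glue_fam U := fun i => sval (sol i).
have tP i : (forall k, res (VUi i k) (t i) = sub_val (s k) i) /\
    (forall r, (forall k, res (VUi i k) r = sub_val (s k) i) -> t i = r).
  exact: proj2_sig (sol i).
have ct : glue_sec U t.
  move=> i j a h; apply: (sec_ext (VU := VUi i)) => // k.
  rewrite (tP i).1 -(sub_valS (s k) i j a (gpre_mp a)) -(tP j).1.
  have k' : opens_preim (mcont (mp a)) (gpre (V k) j) `<=`
    opens_preim (mcont (mp a)) (gpre U j) by move=> p; exact: VUi.
  have l : gpre (V k) i `<=` opens_preim (mcont (mp a)) (gpre U j).
    by move=> p /(VUi i k) /h.
  by rewrite (pull_res _ k') !(res_comp _ _ l).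
exists (mksub ct); split=> [k|r er].
  apply: val_inj; apply: functional_extensionality_dep => i /=.
  by rewrite -(tP i).1; exact: res_irr.
apply: val_inj; apply: functional_extensionality_dep => i /=.
by apply: (tP i).2 => k; rewrite -er; exact: res_irr.
Qed.

Definition glue : lms := Lms glue_res_id glue_res_comp glue_sheafP.

Lemma germ_unit_glue_rel (U : opens glue) (s : sec U) (x y : glue_sum) :
  clos_refl_sym_trans _ glue_step x y ->
  (U (glue_in (gpt x)) /\ germ_unit (gpt x) (sub_val s (gix x)) <->
   U (glue_in (gpt y)) /\ germ_unit (gpt y) (sub_val s (gix y))).
Proof.
elim=> {x y} [_ _ [j k a p]|x|x y _ IH|x y z _ IH1 _ IH2] //=.
- rewrite glue_in_mp -(sub_valS s j k a (gpre_mp a)).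
  split=> -[Up u]; split => //.
    move: u => /germ_unit_res /mlocal; apply => //.
    by rewrite /= glue_in_mp.
  exact/germ_unit_res/germ_unit_pull.
- by rewrite IH.
- by rewrite IH1.
Qed.

Lemma glue_in_eq k l (p : ob k) (q : ob l) : glue_in p = glue_in q ->
  clos_refl_sym_trans _ glue_step (GluePt p) (GluePt q).
Proof. by move/eqP; rewrite eqmodE => /asboolP. Qed.

Lemma glue_unit_locus (U : opens glue) (s : sec U) (x : glue) : U x ->
  (exists k (p : ob k), glue_in p = x /\ germ_unit p (sub_val s k)) ->
  germ_unit x s.
Proof.
pose E (y : glue) := U y /\
  exists k (q : ob k), glue_in q = y /\ germ_unit q (sub_val s k).
have EP k (q : ob k) :
    E (glue_in q) <-> U (glue_in q) /\ germ_unit q (sub_val s k).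
  split=> [[Uq [l [r [e ur]]]]|[Uq uq]].
    have [h _] := germ_unit_glue_rel s (glue_in_eq e).
    by apply: h; split; rewrite //= e.
  by split=> //; exists k, q.
have oE : open E.
  rewrite glue_openE => k.
  have -> : glue_in (i:=k) @^-1` E = \bigcup_(W in
      [set W : opens (ob k) | W `<=` E \o @glue_in k]) (W : set (ob k)).
    apply/seteqP; split=> [q Eq|q [W WE Wq]]; last exact: WE.
    have [Uq uq] := (EP k q).1 Eq.
    have [W [WU Wq uW]] := germ_unit_near uq; exists W => //= r Wr.
    by apply/EP; split; [exact: WU|exact: uW].
  by apply: bigcup_open => W _; exact: oopen.
move=> Ux Ex; have EU : E `<=` U by move=> y [].
pose O : opens glue := Opens oE.
exists O, (EU : O `<=` U); split => //.
have un k : is_unit (sub_val (res (EU : O `<=` U) s) k).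
  apply: germ_unit_all => q /= /EP[Uq uq].
  by apply/germ_unit_res => //; apply/EP.
pose t : glue_fam O := fun k => sval (cid (un k)).
have tP k : sub_val (res (EU : O `<=` U) s) k + t k = 0.
  exact: proj2_sig (cid (un k)).
have ct : glue_sec O t.
  move=> k l a h.
  apply: (@unit_inv_uniq _ (sub_val (res (EU : O `<=` U) s) k)) => //.
  rewrite -(sub_valS (res (EU : O `<=` U) s) k l a h).
  by rewrite -!raddfD tP !raddf0.
exists (mksub ct); apply: val_inj.
by apply: functional_extensionality_dep => k; exact: tP.
Qed.

Section Injection.
Variable i : ix D.

Definition glue_pull (U : opens glue) (s : sec U) :
  sec (opens_preim (@glue_in_continuous i) U) := sub_val s i.

Lemma glue_pull_additive (U : opens glue) : nmod_morphism (@glue_pull U).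
Proof. by []. Qed.

HB.instance Definition _ (U : opens glue) :=
  GRing.isNmodMorphism.Build _ _ (@glue_pull U) (glue_pull_additive U).

Lemma glue_pull_res (U V : opens glue) (h : V `<=` U)
    (k : opens_preim (@glue_in_continuous i) V `<=`
         opens_preim (@glue_in_continuous i) U) (s : sec U) :
  glue_pull (res h s) = res k (glue_pull s).
Proof. exact: res_irr. Qed.

Lemma glue_in_local (p : ob i) (U : opens glue) (s : sec U) :
  U (glue_in p) -> germ_unit p (glue_pull s) -> germ_unit (glue_in p : glue) s.
Proof.
by move=> Up up; apply: glue_unit_locus => //; exists i, p.
Qed.

Definition glue_inj : mor (ob i) glue :=
  @Mor (ob i) glue (@glue_in i) (@glue_in_continuous i)
    (fun U => @glue_pull U) glue_pull_res glue_in_local.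

End Injection.

Lemma glue_inj_mp i j (a : ar D i j) :
  mor_comp (glue_inj j) (mp a) = glue_inj i.
Proof.
apply: mor_ext => [p|U s W h k]; first exact: glue_in_mp.
have l : W `<=` opens_preim (mcont (mp a)) (opens_preim (mcont (glue_inj j)) U).
  exact: h.
rewrite (pull_comp _ h l) /= /glue_pull -(sub_valS s i j a (gpre_mp a)).
by rewrite (res_comp _ _ l).
Qed.

Section Descent.
Variables (Y : lms) (c : forall i : ix D, mor (ob i) Y).
Hypothesis cP : forall i j (a : ar D i j), mor_comp (c j) (mp a) = c i.

Definition desc_fun (x : glue) : Y := c (gix (repr x)) (gpt (repr x)).

Lemma desc_fun_in i (p : ob i) : desc_fun (glue_in p) = c i p.
Proof.
have /glue_in_eq : glue_in (gpt (repr (glue_in p))) = glue_in p.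
  by rewrite -[RHS]reprK /glue_in; case: (repr _).
rewrite /desc_fun; case: (repr _) => j q /= e.
suff H x y : clos_refl_sym_trans _ glue_step x y ->
    c (gix x) (gpt x) = c (gix y) (gpt y) by exact: (H _ _ e).
by elim=> {x y} //= [_ _ [k l a r]|x y z _ -> _ ->] //=; rewrite -(cP a).
Qed.

Lemma desc_continuous : continuous desc_fun.
Proof.
apply/continuousP => V oV; rewrite glue_openE => i.
have -> : glue_in (i:=i) @^-1` (desc_fun @^-1` V) = c i @^-1` V.
  by apply/seteqP; split=> p /=; rewrite desc_fun_in.
by have /continuousP := mcont (c i); apply.
Qed.

Section Pull.
Variable V : opens Y.
Let V' : opens glue := opens_preim desc_continuous V.

Lemma desc_sub i : gpre V' i `<=` opens_preim (mcont (c i)) V.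
Proof. by move=> p; rewrite /= desc_fun_in. Qed.

Definition desc_fam (s : sec V) : glue_fam V' :=
  fun i => res (@desc_sub i) (pull (c i) V s).

Lemma desc_compat s : glue_sec V' (desc_fam s).
Proof.
move=> i j a h; rewrite /desc_fam.
have k : opens_preim (mcont (mp a)) (gpre V' j) `<=`
  opens_preim (mcont (mp a)) (opens_preim (mcont (c j)) V).
  by move=> p; exact: desc_sub.
have l : gpre V' i `<=`
  opens_preim (mcont (mp a)) (opens_preim (mcont (c j)) V).
  by move=> p /h /k.
rewrite (pull_res _ k) (res_comp _ _ l).
have l' : gpre V' i `<=` opens_preim (mcont (mor_comp (c j) (mp a))) V := l.
by rewrite -(pull_comp s l'); exact/mor_eq_pull/cP.
Qed.

Definition desc_pull_fun (s : sec V) : sec V' := mksub (desc_compat s).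

Lemma desc_pull_additive : nmod_morphism desc_pull_fun.
Proof.
split=> [|s t]; apply: val_inj; apply: functional_extensionality_dep => i /=.
  by rewrite /desc_fam !raddf0.
by rewrite /desc_fam !raddfD.
Qed.

HB.instance Definition _ :=
  GRing.isNmodMorphism.Build _ _ desc_pull_fun desc_pull_additive.

Definition desc_pull : {additive sec V -> sec V'} := desc_pull_fun.

End Pull.

Lemma desc_pull_res (V W : opens Y) (h : W `<=` V)
    (k : opens_preim desc_continuous W `<=` opens_preim desc_continuous V)
    (s : sec V) :
  desc_pull W (res h s) = res k (desc_pull V s).
Proof.
apply: val_inj; apply: functional_extensionality_dep => i /=.
rewrite /desc_fam /= /glue_fam_res /=.
have k' : opens_preim (mcont (c i)) W `<=` opens_preim (mcont (c i)) V.
  by move=> p; exact: h.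
have l := subset_trans (@desc_sub W i) k'.
by rewrite (pull_res _ k') !(res_comp _ _ l).
Qed.

Lemma desc_local (x : glue) (V : opens Y) (s : sec V) : V (desc_fun x) ->
  germ_unit x (desc_pull V s) -> germ_unit (desc_fun x) s.
Proof.
have [i [p ->]] := glue_in_surj x; rewrite desc_fun_in => Vp.
move=> /(@germ_unit_pull _ _ (glue_inj i) p) /germ_unit_res u.
by apply: (@mlocal _ _ (c i)) => //; apply: u; rewrite /= desc_fun_in.
Qed.

Definition glue_desc : mor glue Y := Mor desc_pull_res desc_local.

Lemma glue_desc_inj i : mor_comp glue_desc (glue_inj i) = c i.
Proof.
apply: mor_ext => [p|V s W h k]; first exact: desc_fun_in.
have l : W `<=` opens_preim (mcont (glue_inj i)) (opens_preim (mcont glue_desc) V).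
  exact: h.
by rewrite (pull_comp _ h l) [LHS]res_comp.
Qed.

End Descent.

End Gluing.

(** * Monoschemes *)

(* [f] is an isomorphism of X onto an open subspace of Y equipped with the
   restricted sheaf. *)
Definition open_immersion (X Y : lms) (f : mor X Y) :=
  [/\ injective f,
      forall U : set X, open U -> open (f @` U) &
      forall V : opens Y, V `<=` range f -> bijective (pull f V)].

Definition monoscheme (X : lms) := forall x : X,
  exists (M : nmodType) (f : mor (spec M) X), open_immersion f /\ range f x.

Definition saturated_monoscheme (X : lms) := forall x : X,
  exists (M : nmodType) (f : mor (spec M) X),
    [/\ saturated M, open_immersion f & range f x].

(* Fiber products in the full subcategory of saturated monoschemes. *)
Definition saturated_fiber_product (Y Z S : lms) (g : mor Y S) (f : mor Z S)
    (X : lms) (p : mor X Y) (q : mor X Z) :=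
  [/\ saturated_monoscheme X, mor_comp g p = mor_comp f q &
      forall (T : lms) (a : mor T Y) (b : mor T Z), saturated_monoscheme T ->
        mor_comp g a = mor_comp f b ->
        exists! u : mor T X, mor_comp p u = a /\ mor_comp q u = b].

(** * Fans *)

Section Cones.
Variables (R : realType) (n : nat).
Implicit Types sigma tau : set 'rV[R]_n.

Definition rational_polyhedral sigma := exists k (v : 'I_k -> 'rV[int]_n),
  sigma = [set x | exists2 c : 'I_k -> R, (forall i, 0 <= c i) &
                   x = \sum_i c i *: map_mx intr (v i)].

Definition strongly_convex sigma := forall x, sigma x -> sigma (- x) -> x = 0.

Definition face tau sigma :=
  exists2 u : 'cV[R]_n, (forall x, sigma x -> 0 <= (x *m u) 0 0) &
                        tau = [set x | sigma x /\ (x *m u) 0 0 = 0].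

(* A fan in the lattice Z^n, whose elements are row vectors. *)
Record fan := Fan {
  cones :> set 'rV[R]_n -> Prop;
  fan_finite : finite_set cones;
  fan_cone : forall sigma, cones sigma ->
    rational_polyhedral sigma /\ strongly_convex sigma;
  fan_face : forall sigma tau, cones sigma -> face tau sigma -> cones tau;
  fan_inter : forall sigma tau, cones sigma -> cones tau ->
    face (sigma `&` tau) sigma /\ face (sigma `&` tau) tau }.

Definition support (Sigma : fan) : set 'rV[R]_n :=
  \bigcup_(sigma in (Sigma : set _)) sigma.

(* The monoid of the linear forms on Z^n, seen as column vectors, which are
   nonnegative on sigma. *)
Definition dual_pred sigma (u : 'cV[int]_n) :=
  forall x, sigma x -> 0 <= (x *m map_mx intr u) 0 0.

Lemma dual_pred0 sigma : dual_pred sigma 0.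
Proof. by move=> x _; rewrite map_mx0 mulmx0 mxE. Qed.

Lemma dual_predD sigma u v :
  dual_pred sigma u -> dual_pred sigma v -> dual_pred sigma (u + v).
Proof.
move=> su sv x sx; rewrite map_mxD mulmxDr mxE.
by apply: addr_ge0; [exact: su|exact: sv].
Qed.

Definition dual_monoid sigma : nmodType :=
  sub_of (Submonoid (@dual_pred0 sigma) (@dual_predD sigma)).

End Cones.

Section DualMap.
Variables (R : realType) (n m : nat) (A : 'M[int]_(n, m)).
Variables (sigma : set 'rV[R]_n) (tau : set 'rV[R]_m).
Hypothesis h : [set x *m map_mx intr A | x in sigma] `<=` tau.

Lemma dual_map_subproof (u : 'cV[int]_m) :
  dual_pred tau u -> dual_pred sigma (A *m u).
Proof.
move=> tu x sx; rewrite map_mxM mulmxA.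
by apply: tu; apply: h; exists x.
Qed.

Definition dual_map : {additive dual_monoid tau -> dual_monoid sigma} :=
  @sub_map _ _ (Submonoid (@dual_pred0 _ _ tau) (@dual_predD _ _ tau))
    (Submonoid (@dual_pred0 _ _ sigma) (@dual_predD _ _ sigma))
    (mulmx A) dual_map_subproof.

End DualMap.

Section FanMonoscheme.
Variables (R : realType) (n : nat) (Sigma : fan R n).

Definition dual_incl (sigma tau : set 'rV[R]_n) (h : tau `<=` sigma) :
    {additive dual_monoid sigma -> dual_monoid tau} :=
  @sub_map _ _ (Submonoid (@dual_pred0 _ _ sigma) (@dual_predD _ _ sigma))
    (Submonoid (@dual_pred0 _ _ tau) (@dual_predD _ _ tau))
    idfun (fun u su x tx => su x (h x tx)).

Lemma face_sub (sigma tau : set 'rV[R]_n) : face tau sigma -> tau `<=` sigma.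
Proof. by move=> [u _ ->] x []. Qed.

(* The charts are glued along the open immersions given by the face
   inclusions; as any two cones of a fan meet in a common face, this glues the
   charts of sigma and tau along the chart of their intersection. *)
Definition fan_diagram : diagram := @Diagram
  {sigma | Sigma sigma}
  (fun sigma => spec (dual_monoid (sval sigma)))
  (fun tau sigma => face (sval tau) (sval sigma))
  (fun tau sigma h => spec_map (dual_incl (face_sub h))).

Definition fan_monoscheme : lms := glue fan_diagram.

Definition fan_chart (sigma : {sigma | Sigma sigma}) :
    mor (spec (dual_monoid (sval sigma))) fan_monoscheme :=
  @glue_inj fan_diagram sigma.

End FanMonoscheme.

Section FanMorphisms.
Variables (R : realType) (n m : nat) (Delta : fan R n) (Sigma : fan R m).

Record fan_mor := FanMor {
  lat : 'M[int]_(n, m);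
  lat_cone : forall sigma, Delta sigma -> exists2 sigma' : set 'rV[R]_m,
    Sigma sigma' & [set x *m map_mx intr lat | x in sigma] `<=` sigma' }.

Variable f : fan_mor.

Lemma fan_chart_indep (sigma tau : {sigma | Sigma sigma}) (rho : set 'rV[R]_n)
    (hs : [set x *m map_mx intr (lat f) | x in rho] `<=` sval sigma)
    (ht : [set x *m map_mx intr (lat f) | x in rho] `<=` sval tau) :
  mor_comp (fan_chart sigma) (spec_map (dual_map hs)) =
  mor_comp (fan_chart tau) (spec_map (dual_map ht)).
Proof.
have [fs ft] := fan_inter (proj2_sig sigma) (proj2_sig tau).
pose kappa : {sigma | Sigma sigma} :=
  exist _ (sval sigma `&` sval tau) (fan_face (proj2_sig sigma) fs).
have hk : [set x *m map_mx intr (lat f) | x in rho] `<=` sval kappa.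
  by move=> x rx; split; [exact: hs|exact: ht].
suff H (ups : {sigma | Sigma sigma}) (fk : face (sval kappa) (sval ups))
    (hu : [set x *m map_mx intr (lat f) | x in rho] `<=` sval ups) :
    mor_comp (fan_chart ups) (spec_map (dual_map hu)) =
    mor_comp (fan_chart kappa) (spec_map (dual_map hk)).
  by rewrite (H sigma fs) (H tau ft).
rewrite /fan_chart -(@glue_inj_mp (fan_diagram Sigma) kappa ups fk) -mor_compA.
congr mor_comp; apply/esym; apply: spec_map_comp => u.
exact: val_inj.
Qed.

Definition fan_target (sigma : {sigma | Delta sigma}) : {sigma' |
    Sigma sigma' &
    [set x *m map_mx intr (lat f) | x in sval sigma] `<=` sigma'} :=
  cid2 (lat_cone f (proj2_sig sigma)).

Definition fan_map_on (sigma : {sigma | Delta sigma}) :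
    mor (spec (dual_monoid (sval sigma))) (fan_monoscheme Sigma) :=
  mor_comp (fan_chart (exist _ (s2val (fan_target sigma))
                               (s2valP (fan_target sigma))))
    (spec_map (dual_map (s2valP' (fan_target sigma)))).

Lemma fan_map_on_compat (tau sigma : {sigma | Delta sigma})
    (h : face (sval tau) (sval sigma)) :
  mor_comp (fan_map_on sigma) (spec_map (dual_incl (face_sub h))) =
  fan_map_on tau.
Proof.
rewrite /fan_map_on -mor_compA.
have h' : [set x *m map_mx intr (lat f) | x in sval tau] `<=`
    s2val (fan_target sigma).
  move=> _ [x tx <-]; apply: (s2valP' (fan_target sigma)).
  by exists x => //; exact: face_sub h _ tx.
rewrite (@spec_map_comp _ _ _ _ _ (dual_map h')); last first.
  by move=> u; exact: val_inj.
exact: fan_chart_indep.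
Qed.

(* The morphism of monoschemes induced by [f]: on the chart of sigma it is
   dual to f for any choice of a cone of Sigma containing the image of sigma
   (lemma [fan_map_chart]). *)
Definition fan_map : mor (fan_monoscheme Delta) (fan_monoscheme Sigma) :=
  @glue_desc (fan_diagram Delta) _ fan_map_on fan_map_on_compat.

Lemma fan_map_chart (sigma : {sigma | Delta sigma})
    (sigma' : {sigma | Sigma sigma})
    (h : [set x *m map_mx intr (lat f) | x in sval sigma] `<=` sval sigma') :
  mor_comp fan_map (fan_chart sigma) =
  mor_comp (fan_chart sigma') (spec_map (dual_map h)).
Proof.
transitivity (fan_map_on sigma); last exact: fan_chart_indep.
exact: (@glue_desc_inj (fan_diagram Delta)).
Qed.

Definition partial_subdivision :=
  bijective (fun v : 'rV[int]_n => v *m lat f).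

Definition subdivision := partial_subdivision /\
  [set x *m map_mx intr (lat f) | x in support Delta] = support Sigma.

End FanMorphisms.

(* Main.v *)
From HB Require Import structures.
From Stdlib Require Import Relation_Operators.
Require Import Defs.
From mathcomp Require Import all_boot all_order all_algebra.
From mathcomp Require Import all_classical all_reals topology.
From mathcomp Require Import ring.
(* Imported last, so that [frac] denotes the fractions of a monoid rather than
   those of an integral domain. *)
Import Defs.

Set Implicit Arguments.
Unset Strict Implicit.
Unset Printing Implicit Defensive.

Import Order.TTheory GRing.Theory Num.Theory.
Local Open Scope classical_set_scope.
Local Open Scope ring_scope.

(** As in the valuative criterion of properness, the fiber product is [spec P]
    itself because the morphism [g] has exactly one lift [h] to the subdivision,
    and because a partial subdivision is a monomorphism: any pair of morphisms
    [a] to [spec P] and [b] to [Delta] that agree over [Sigma] then satisfies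
    [b = h a].  That the projection of an arbitrary fiber product is an
    isomorphism follows formally.

    Both facts are reduced to linear algebra by a description of the morphisms
    from a spectrum to a fan.  The stalks of the monoscheme of a fan embed into
    the lattice of linear forms, so that a point is determined by the submonoid
    of the forms that are regular there ([forms_at_inj]), and a section is a
    function with values in the lattice which locally is constant
    ([sec_locally_chi]).  Every open set that contains the closed point of a
    spectrum is the whole spectrum.  Hence a morphism from [spec Q] to a fan
    factors through the chart of a cone [s], and it is given by a homomorphism
    from the dual monoid of [s] to [Q] ([mor_spec_fan]).  When [Q] is integral,
    such a morphism only depends on the homomorphism it induces from the lattice
    of all linear forms to the group of [Q], and not on the cone
    ([chart_mor_lattice], [chart_mor_eq]): if two cones are possible, then a
    form which separates them is mapped to a unit, and both morphisms factor
    through the chart of the intersection.  As the lattices of a fan and of its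
    subdivision are the same, a partial subdivision is a monomorphism
    ([fan_map_mono]).

    For the existence of the lift, let [g] be given by a homomorphism [Phi]
    from the lattice to the group of [P] which is nonnegative, in the sense
    that its values are in [P], on the dual of a cone [t]. One has to find a
    cone of the subdivision on whose dual [Phi] is nonnegative as well
    ([valuative_cone]). If there is none, choose for every cone [s] of the
    subdivision a form in the dual of [s] with a negative value. A theorem of
    the alternative ([ville]), which is a consequence of the Farkas lemma,
    shows that either some point of [t] is negative on all these forms,
    although it lies in one of the cones [s], or a combination of these forms,
    whose coefficients are natural numbers and not all zero, lies in the dual
    of [t], although its value is negative. *)

(** * Linear inequalities over the integers *)

Local Notation dot x u := ((x *m u) 0 0).

Section Dot.
Variables (K : comNzRingType) (n : nat).
Implicit Types (x y : 'rV[K]_n) (u v : 'cV[K]_n) (a : K).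

Lemma dotDl x y u : dot (x + y) u = dot x u + dot y u.
Proof. by rewrite mulmxDl mxE. Qed.

Lemma dotDr x u v : dot x (u + v) = dot x u + dot x v.
Proof. by rewrite mulmxDr mxE. Qed.

Lemma dotNl x u : dot (- x) u = - dot x u.
Proof. by rewrite mulNmx mxE. Qed.

Lemma dotNr x u : dot x (- u) = - dot x u.
Proof. by rewrite mulmxN mxE. Qed.

Lemma dotZl a x u : dot (a *: x) u = a * dot x u.
Proof. by rewrite -scalemxAl mxE. Qed.

Lemma dotZr a x u : dot x (a *: u) = a * dot x u.
Proof. by rewrite -scalemxAr mxE. Qed.

Lemma dot_suml (I : Type) (r : seq I) (P : pred I) (F : I -> 'rV[K]_n) u :
  dot (\sum_(i <- r | P i) F i) u = \sum_(i <- r | P i) dot (F i) u.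
Proof. by rewrite mulmx_suml summxE. Qed.

Lemma dot_sumr (I : Type) (r : seq I) (P : pred I) (F : I -> 'cV[K]_n) x :
  dot x (\sum_(i <- r | P i) F i) = \sum_(i <- r | P i) dot x (F i).
Proof. by rewrite mulmx_sumr summxE. Qed.

Lemma dotMn k x u : dot x (u *+ k) = dot x u *+ k.
Proof. by rewrite -scaler_nat dotZr mulr_natl. Qed.

End Dot.

Lemma dot_map (K L : comNzRingType) (h : {rmorphism K -> L}) n
    (x : 'rV[K]_n) (u : 'cV[K]_n) :
  dot (map_mx h x) (map_mx h u) = h (dot x u).
Proof. by rewrite -map_mxM mxE. Qed.

Definition cone (F : realFieldType) n k (v : 'I_k -> 'rV[F]_n) : set 'rV[F]_n :=
  [set x | exists2 c : 'I_k -> F, (forall i, 0 <= c i) & x = \sum_i c i *: v i].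

(** By induction on the number of generators.  If [u] separates [w] from the
    cone of all generators but [v ord0] and is negative on [v ord0], then
    everything is projected to the kernel of [u] along [v ord0]. *)
Lemma farkas (F : realFieldType) n k (v : 'I_k -> 'rV[F]_n) (w : 'rV[F]_n) :
  cone v w \/
  exists2 u : 'cV[F]_n, (forall i, 0 <= dot (v i) u) & dot w u < 0.
Proof.
elim: k v w => [|k IH] v w.
  have [->|w0] := eqVneq w 0; first by left; exists (fun=> 0); rewrite ?big_ord0.
  right; exists (- w^T) => [[]//|]; rewrite dotNr oppr_lt0 mxE.
  have [j wj] : exists j, w 0 j != 0.
    by apply/existsP; apply: contraNT w0 => /existsPn w0; apply/eqP/rowP => j;
      rewrite mxE; apply/eqP; move: (w0 j); rewrite negbK.
  rewrite (bigD1 j) //= mxE; apply: ltr_pwDl.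
    by rewrite -expr2 exprn_even_gt0.
  by apply: sumr_ge0 => i _; rewrite mxE -expr2 sqr_ge0.
have [[c c0 ->]|[u u0 wu]] := IH (fun i => v (lift ord0 i)) w.
  left; exists (fun i => if unlift ord0 i is Some j then c j else 0).
    by move=> i; case: (unliftP ord0 i) => [j|] _.
  rewrite big_ord_recl unlift_none scale0r add0r.
  by apply: eq_bigr => i _; rewrite liftK.
have [v0u|v0u] := lerP 0 (dot (v ord0) u).
  by right; exists u => // i; case: (unliftP ord0 i) => [j|] ->.
(* The projection is x |-> x - r x *: v ord0. *)
pose r (x : 'rV[F]_n) := dot x u / dot (v ord0) u.
have [[c c0 ew]|[u' u0' wu']] :=
    IH (fun i => v (lift ord0 i) - r (v (lift ord0 i)) *: v ord0)
       (w - r w *: v ord0).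
  left; pose c' := r w - \sum_i c i * r (v (lift ord0 i)).
  exists (fun i => if unlift ord0 i is Some j then c j else c').
    move=> i; case: (unliftP ord0 i) => [j|] _ //; rewrite /c' /r.
    have n0 : (dot (v ord0) u)^-1 <= 0 by rewrite invr_le0 ltW.
    rewrite subr_ge0; apply: (@le_trans _ _ 0).
      by apply: sumr_le0 => j _; rewrite mulr_ge0_le0 // mulr_ge0_le0.
    by rewrite mulr_le0 // ltW.
  rewrite big_ord_recl unlift_none; under eq_bigr do rewrite liftK.
  rewrite -[LHS](subrK (r w *: v ord0)) ew /c' scalerBl.
  under [in LHS]eq_bigr do rewrite scalerBr scalerA.
  by rewrite big_split /= sumrN -scaler_suml [LHS]addrAC [RHS]addrC addrA.
right; exists (u' - (dot (v ord0) u' / dot (v ord0) u) *: u).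
  move=> i; case: (unliftP ord0 i) => [j|] ->; rewrite dotDr dotNr dotZr.
    have := u0' j; rewrite dotDl dotNl dotZl /r.
    by congr (_ <= _); ring.
  by rewrite divfK ?subrr // lt_eqF.
have := wu'; rewrite dotDr dotNr dotZr dotDl dotNl dotZl /r.
by congr (_ < _); ring.
Qed.

Lemma clear_denominators n (u : 'cV[rat]_n) :
  exists (d : int) (u' : 'cV[int]_n), 0 < d /\ map_mx intr u' = d%:~R *: u.
Proof.
exists (\prod_i denq (u i 0)),
  (\col_i (numq (u i 0) * \prod_(j | j != i) denq (u j 0))).
split; first by apply: prodr_gt0 => i _; exact: denq_gt0.
apply/colP => i; rewrite !mxE [in RHS](bigD1 i) //= !intrM.
by rewrite numqE [RHS]mulrC mulrA.
Qed.

Section IntegerInequalities.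
Variable R : realFieldType.

Local Notation real := (map_mx (intr : int -> R)).

Lemma dot_real n (x : 'rV[int]_n) (u : 'cV[int]_n) :
  dot (real x) (real u) = (dot x u)%:~R.
Proof. exact: dot_map. Qed.

(** The Farkas lemma is applied over the rational numbers, because the form
    must become integral after clearing its denominators. *)
Lemma farkas_int n k (v : 'I_k -> 'rV[int]_n) (w : 'rV[int]_n) :
  cone (fun i => real (v i)) (real w) \/
  exists2 u : 'cV[int]_n, (forall i, 0 <= dot (v i) u) & dot w u < 0.
Proof.
have intr_ratr m p (x : 'M[int]_(m, p)) : map_mx ratr (map_mx intr x) = real x.
  by apply/matrixP => i j; rewrite !mxE ratr_int.
have [[c c0 ew]|[u u0 wu]] :=
    @farkas rat n k (fun i => map_mx intr (v i)) (map_mx intr w).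
  left; exists (fun i => ratr (c i)) => [i|]; first by rewrite ler0q.
  rewrite -intr_ratr ew map_mx_sum; apply: eq_bigr => i _.
  by rewrite map_mxZ intr_ratr.
have [d [u' [d0 eu]]] := clear_denominators u.
have du (x : 'rV[int]_n) : (dot x u')%:~R = d%:~R * dot (map_mx intr x) u :> rat.
  by rewrite -dotZr -eu dot_map.
right; exists u' => [i|].
  by rewrite -(ler0z rat) du mulr_ge0 // ler0z ltW.
by rewrite -(ltrz0 rat) du pmulr_rlt0 // ltr0z.
Qed.

(** An integral point in the relative interior of the dual of the cone
    spanned by [v]: it is positive on every generator whose opposite is not in
    the cone, as the Farkas lemma provides a linear form for each of these, and
    these forms may be added. *)
Lemma relative_interior n k (v : 'I_k -> 'rV[int]_n) :
  exists u : 'cV[int]_n, forall i, 0 <= dot (v i) u /\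
    (dot (v i) u = 0 -> cone (fun j => real (v j)) (- real (v i))).
Proof.
have /boolp.choice[u uP] i : exists u : 'cV[int]_n,
    (forall j, 0 <= dot (v j) u) /\
    (dot (v i) u <= 0 -> cone (fun j => real (v j)) (- real (v i))).
  have [vi|[u u0 ui]] := farkas_int v (- v i).
    by exists 0; split=> [j|_]; rewrite ?mulmx0 ?mxE // -raddfN.
  by exists u; split=> //; move: ui; rewrite dotNl oppr_lt0 ltNge => /negP.
exists (\sum_i u i) => i; rewrite dot_sumr; split.
  by apply: sumr_ge0 => j _; exact: (uP j).1.
move=> e; apply: (uP i).2; rewrite -e (bigD1 i) //= lerDl.
by apply: sumr_ge0 => j _; exact: (uP j).1.
Qed.

(** A theorem of the alternative due to Ville.  The second case comes from an
    integral point in the relative interior of the dual of the cone spanned by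
    the rows of [B] and the standard basis; if that point is zero, the
    opposites of all basis vectors are in the cone, and their sum gives the
    first case. *)
Lemma ville k l (B : 'M[int]_(k, l)) :
  (exists2 c : 'I_k -> R, (forall i, 0 <= c i) &
     forall j, \sum_i c i * (B i j)%:~R < 0) \/
  (exists2 y : 'I_l -> nat, (exists j, (0 < y j)%N) &
     forall i, 0 <= \sum_j B i j *+ y j).
Proof.
pose v (i : 'I_(k + l)) : 'rV[int]_l :=
  match fintype.split i with inl i => row i B | inr j => delta_mx 0 j end.
have vl i : v (lshift l i) = row i B.
  by rewrite /v -[lshift l i]/(unsplit (inl i)) unsplitK.
have vr j : v (rshift k j) = delta_mx 0 j.
  by rewrite /v -[rshift k j]/(unsplit (inr j)) unsplitK.
have [u uP] := relative_interior v.
have dr j : dot (v (rshift k j)) u = u j 0 by rewrite vr -rowE mxE.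
have u0 j : 0 <= u j 0 by rewrite -dr; exact: (uP _).1.
have [[j uj]|uz] := pselect (exists j, u j 0 != 0).
  right; exists (fun j => absz (u j 0)); first by exists j; rewrite absz_gt0.
  move=> i; have := (uP (lshift l i)).1; rewrite vl.
  rewrite mxE; congr (_ <= _); apply: eq_bigr => j' _.
  by rewrite mxE -mulr_natr natz gez0_abs.
have cj j : {c : 'I_(k + l) -> R | (forall i, 0 <= c i) &
    - real (delta_mx 0 j) = \sum_i c i *: real (v i)}.
  apply: cid2; rewrite -vr; apply: (uP _).2; rewrite dr; apply/eqP.
  by apply: contrapT => /negP uj; apply: uz; exists j.
pose c j := s2val (cj j).
have c0 j i : 0 <= c j i by exact: (s2valP (cj j)).
have cE j j' : \sum_(i < k) c j (lshift l i) * (B i j')%:~R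
    = - (j == j')%:R - c j (rshift k j').
  have /rowP/(_ j') := s2valP' (cj j); rewrite big_split_ord mxE.
  rewrite [RHS]mxE !summxE [X in _ + X](bigD1 j') //= [X in _ + (_ + X)]big1.
    rewrite addr0 vr !mxE !eqxx mulr1 eq_sym mulrz_nat /= => ->.
    by rewrite addrK; apply: eq_bigr => i _; rewrite vl !mxE.
  by move=> i ij'; rewrite vr !mxE (eq_sym j') (negPf ij') mulr0.
left; exists (fun i => \sum_j c j (lshift l i)).
  by move=> i; apply: sumr_ge0 => j _; exact: c0.
move=> j'; under eq_bigr do rewrite mulr_suml.
rewrite exchange_big /=; under eq_bigr do rewrite cE.
rewrite big_split /= !sumrN -opprD oppr_lt0 (bigD1 j') //= eqxx.
apply: ltr_wpDr; first by apply: sumr_ge0 => j _; exact: c0.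
by apply: ltr_pwDl; rewrite ?ltr01 // sumr_ge0 // => j _; exact: ler0n.
Qed.

End IntegerInequalities.

(** * Morphisms of locally monoidal spaces *)

Lemma mor_comp_idl (X Y : lms) (f : mor X Y) : mor_comp (mor_id Y) f = f.
Proof.
apply: mor_ext => // V s W h k.
have l : W `<=` opens_preim (mcont f) (opens_preim (mcont (mor_id Y)) V) := h.
rewrite (pull_comp _ h l) /= /id_pull.
have r : opens_preim (mcont f) (opens_preim (mcont (mor_id Y)) V) `<=`
  opens_preim (mcont f) V by [].
by rewrite (pull_res _ r) (res_comp _ _ k).
Qed.

Lemma mor_comp_idr (X Y : lms) (f : mor X Y) : mor_comp f (mor_id X) = f.
Proof.
apply: mor_ext => // V s W h k.
have l : W `<=` opens_preim (mcont (mor_id X)) (opens_preim (mcont f) V) := h.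
by rewrite (pull_comp _ h l) /= /id_pull (res_comp _ _ k).
Qed.

(** An open immersion induces bijections on the sections over the open subsets
    of its image, and these images cover the source. *)
Lemma mor_eq_local (X Y : lms) (f g : mor X Y) :
  (forall x, exists (Z : lms) (j : mor Z X),
     [/\ open_immersion j, range j x & mor_comp f j = mor_comp g j]) -> f = g.
Proof.
move=> loc; apply: mor_ext => [x|V s W h k].
  have [Z [j [_ [z _ <-] e]]] := loc x.
  exact: (congr1 (fun u : mor Z Y => u z) e).
pose im (x : {x | W x}) (N : opens X) :=
  exists (Z : lms) (j : mor Z X),
    [/\ open_immersion j, mor_comp f j = mor_comp g j, N `<=` range j,
        N `<=` W & N (sval x)].
have /boolp.choice[N NP] x : exists N, im x N.
  case: x => x Wx; have [Z [j [oj jx e]]] := loc x.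
  have orj : open (range j) by case: oj => _ oj _; apply/oj/openT.
  exists (Opens (openI (oopen W) orj : open (fun y => W y /\ range j y))).
  by exists Z, j; split=> // y [].
have NW x : N x `<=` W by have [Z [j []]] := NP x.
apply: (sec_ext (VU := NW)) => [x Wx|x].
  by exists (exist _ x Wx) => //; have [Z [j []]] := NP (exist _ x Wx).
have [Z [j [[_ _ bij] e Nj _ _]]] := NP x.
have hf := subset_trans (NW x) h; have hg := subset_trans (NW x) k.
rewrite (res_comp _ _ hf) (res_comp _ _ hg).
apply: (bij_inj (bij _ Nj)).
have kf : opens_preim (mcont j) (N x) `<=`
  opens_preim (mcont j) (opens_preim (mcont f) V) by move=> z /hf.
have kg : opens_preim (mcont j) (N x) `<=`
  opens_preim (mcont j) (opens_preim (mcont g) V) by move=> z /hg.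
rewrite (pull_res _ kf) (pull_res _ kg).
have lf : opens_preim (mcont j) (N x) `<=` opens_preim (mcont (mor_comp f j)) V.
  exact: kf.
have lg : opens_preim (mcont j) (N x) `<=` opens_preim (mcont (mor_comp g j)) V.
  exact: kg.
by rewrite -(pull_comp _ lf) -(pull_comp _ lg); exact: mor_eq_pull.
Qed.

Lemma open_immersion_id (X : lms) : open_immersion (mor_id X).
Proof.
split=> [//|U oU|V _]; first by rewrite image_id.
have l : V `<=` opens_preim (mcont (mor_id X)) V by [].
exists (res l) => s; rewrite /= /id_pull.
  by rewrite (res_comp _ _ (@subset_refl _ V)) res_id.
by rewrite (res_comp _ _ (@subset_refl _ (opens_preim _ V))) res_id.
Qed.

(** * Sections over a spectrum *)

Section Spectrum.
Variable M : nmodType.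
Implicit Types (a b : M) (q : spec M) (U : opens (spec M)).

Lemma unit_compl q a : is_unit a -> ~ q a.
Proof.
case=> b ab qa; apply: (@compl0 M q); rewrite -ab.
by case: (pprime q) => qD _ _; exact: qD.
Qed.

Lemma spec_sec_ext U (s t : sec U) :
  (forall q (Uq : U q), sub_val s (exist _ q Uq) = sub_val t (exist _ q Uq)) ->
  s = t.
Proof.
by move=> st; apply: val_inj; apply: functional_extensionality_dep => -[q Uq];
  exact: st.
Qed.

Definition const_stalks U a : stalks U :=
  fun x => frac (compl (sval x)) a (@compl0 M (sval x)).

Arguments const_stalks : clear implicits.

Lemma locally_frac_const U a : locally_frac (const_stalks U a).
Proof.
move=> q Uq; exists setT, a, 0; split; [exact: openT|by []|].
by move=> r Ur _; exists (@compl0 M r).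
Qed.

Definition const_sec U a : sec U :=
  @mksub _ (spec_sec U) _ (@locally_frac_const U a).

Arguments const_sec : clear implicits.

Lemma const_secD U a b : const_sec U (a + b) = const_sec U a + const_sec U b.
Proof.
apply: spec_sec_ext => q Uq; rewrite [RHS]fracD /=.
by apply/fracP; exists 0; rewrite ?addr0 //; exact: compl0.
Qed.

Lemma res_const_sec U (V : opens (spec M)) (h : V `<=` U) a :
  res h (const_sec U a) = const_sec V a.
Proof. exact: spec_sec_ext. Qed.

Lemma germ_unit_const U q a : U q -> germ_unit q (const_sec U a) <-> ~ q a.
Proof.
move=> Uq; split=> [[W [h [Wq [t]]]]|qa].
  rewrite res_const_sec => /(congr1 (fun r : sec W => sub_val r (exist _ q Wq))).
  move=> e; apply: (@frac_unit _ q a 0 (@compl0 M q)).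
  by exists (sub_val t (exist _ q Wq)).
have oD : open (fun r : spec M => U r /\ ~ r a).
  apply: openI; first exact: oopen.
  by rewrite spec_openE => r ra; exists a.
pose W := Opens oD; have h : W `<=` U by move=> r [].
exists W, h; split; first by [].
have Wa (r : spec M) : W r -> compl r a by case.
pose t : stalks W := fun x => frac (compl (sval x)) 0 (Wa _ (proj2_sig x)).
have lt : spec_sec W t.
  move=> r Wr; exists setT, 0, a; split; [exact: openT|by []|].
  by move=> r' Wr' _; exists (Wa _ Wr').
exists (mksub lt); rewrite res_const_sec; apply: spec_sec_ext => r Wr.
rewrite [LHS]fracD [RHS]frac0; apply/fracP; exists 0; first exact: compl0.
by rewrite !addr0 !add0r.
Qed.

Lemma closed_point_prime : prime_ideal (fun a => ~ is_unit a).
Proof.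
split=> [a b na [c abc]||a b nab].
    by apply: na; exists (b + c); rewrite addrA.
  by apply; exists 0; rewrite addr0.
have [[c ac]|na] := pselect (is_unit a); last by left.
right => -[d bd]; apply: nab; exists (c + d).
by rewrite addrACA ac bd addr0.
Qed.

Definition closed_point : spec M := SpecPt closed_point_prime.

Lemma compl_closed_point a : compl closed_point a -> is_unit a.
Proof. by move/contrapT. Qed.

Lemma closed_point_open U q : U closed_point -> U q.
Proof.
by move=> /(oopen U)[a /compl_closed_point ua aU]; apply: aU; exact: unit_compl.
Qed.

(** Near the closed point, hence everywhere, the section is given by a single
    fraction, and its denominator is a unit. *)
Lemma sec_closed_point U (s : sec U) :
  U closed_point -> exists a, s = const_sec U a.
Proof.
move=> Uc; have [W [a [b [oW Wc es]]]] := sub_valS s closed_point Uc.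
have [cb _] := es _ Uc Wc; have [c bc] := compl_closed_point cb.
exists (a + c); apply: spec_sec_ext => q Uq.
have [|qb ->] := es q Uq; first exact: (@closed_point_open (Opens oW)).
apply/fracP; exists 0; first exact: compl0.
by rewrite !add0r addr0 -addrA [c + b]addrC bc addr0.
Qed.

Lemma const_sec_inj U a b :
  U closed_point -> const_sec U a = const_sec U b -> a = b.
Proof.
move=> Uc /(congr1 (fun s : sec U => sub_val s (exist _ _ Uc))) /fracP.
move=> [u /compl_closed_point[v uv]]; rewrite !addr0 => e.
by rewrite -[a]add0r -[b]add0r -uv -!addrA ![v + _]addrC !addrA e.
Qed.

End Spectrum.

Arguments const_sec {M} U a.

Lemma pull_const_sec (M N : nmodType) (f : {additive M -> N})
    (V : opens (spec M)) a :
  pull (spec_map f) V (const_sec V a) = const_sec _ (f a).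
Proof.
apply: spec_sec_ext => q Vq; rewrite /= /stalks_pull /=.
rewrite spec_stalk_mapE; apply/fracP; exists 0; first exact: compl0.
by rewrite raddf0.
Qed.

(** * Cones of a fan *)

Section Fans.
Variables (R : realType) (n : nat).
Implicit Types (sigma tau : set 'rV[R]_n) (u w : 'cV[int]_n).

Lemma face_absorb sigma tau x y :
  face tau sigma -> sigma x -> sigma y -> tau (x + y) -> tau x.
Proof.
move=> [u u0 ->] sx sy [_]; rewrite dotDl => /eqP.
by rewrite paddr_eq0 ?u0 // => /andP[/eqP].
Qed.

Lemma cone_gen (F : realFieldType) k (v : 'I_k -> 'rV[F]_n) i : cone v (v i).
Proof.
exists (fun j => (j == i)%:R) => [j|]; first exact: ler0n.
rewrite (bigD1 i) //= eqxx scale1r big1 ?addr0 // => j /negPf ->.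
by rewrite scale0r.
Qed.

Lemma dual_pred_cone k (v : 'I_k -> 'rV[int]_n) u :
  dual_pred (cone (fun i => map_mx intr (v i) : 'rV[R]_n)) u <->
  forall i, 0 <= dot (v i) u.
Proof.
split=> [du i|u0 _ [c c0 ->]].
  rewrite -(ler0z R) -dot_real; apply: du.
  exact: (@cone_gen R k (fun i => map_mx intr (v i))).
rewrite dot_suml; apply: sumr_ge0 => i _.
by rewrite dotZl dot_real mulr_ge0 // ler0z.
Qed.

(** On the generators where the integral form [u] does not vanish, it is at
    least 1 and a large multiple of it outweighs [w]; the other generators are
    in [tau], where [w] is nonnegative. *)
Lemma dual_shift k (v : 'I_k -> 'rV[int]_n) tau u w :
  (forall i, 0 <= dot (v i) u) ->
  (forall i, dot (v i) u = 0 -> tau (map_mx intr (v i))) -> dual_pred tau w ->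
  exists j, dual_pred (cone (fun i => map_mx intr (v i) : 'rV[R]_n)) (w + u *+ j).
Proof.
move=> u0 ut dw; exists (\sum_i absz (dot (v i) w)).
apply/dual_pred_cone => i; rewrite dotDr dotMn.
have [/ut /dw|vu] := eqVneq (dot (v i) u) 0.
  by rewrite dot_real ler0z => vw; rewrite addr_ge0 // mulrn_wge0.
rewrite -lerBlDl sub0r (bigD1 i) //= mulrnDr ler_wpDr ?mulrn_wge0 //.
apply: (@le_trans _ _ (1 *+ absz (dot (v i) w))).
  by rewrite natz abszE -normrN ler_norm.
by rewrite lerMn2r -gtz0_ge1 lt_def vu u0 orbT.
Qed.

(** The dual is full-dimensional: a form in its relative interior is positive on
    all nonzero generators, because a strongly convex cone contains no line. *)
Lemma dual_generates sigma :
  rational_polyhedral sigma -> strongly_convex sigma ->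
  exists2 u, dual_pred sigma u &
    forall w, exists k, dual_pred sigma (w + u *+ k).
Proof.
move=> [k [v ->]] sc; have [u uP] := relative_interior R v.
exists u; first by apply/dual_pred_cone => i; exact: (uP i).1.
move=> w; apply: (@dual_shift _ _ [set 0]).
- by move=> i; exact: (uP i).1.
- move=> i /(uP i).2 vi; apply: sc => //.
  exact: (@cone_gen R k (fun i => map_mx intr (v i))).
- by move=> _ ->; rewrite mul0mx mxE.
Qed.

Variable Sigma : fan R n.

(** The form [u] is in the relative interior of the dual of [sigma - tau].  It
    vanishes on [sigma] only in [sigma `&` tau], because a generator of [sigma]
    whose opposite is in [sigma - tau] is absorbed by this face. *)
Lemma fan_separation sigma tau : Sigma sigma -> Sigma tau ->
  exists u, [/\ dual_pred sigma u, dual_pred tau (- u) &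
    forall w, dual_pred (sigma `&` tau) w ->
      exists k, dual_pred sigma (w + u *+ k)].
Proof.
move=> Ss St; have [fs _] := fan_inter Ss St.
have [k [v es]] := (fan_cone Ss).1; have [l [t et]] := (fan_cone St).1.
rewrite -[X in sigma = X]/(cone (fun i => map_mx intr (v i))) in es.
rewrite -[X in tau = X]/(cone (fun i => map_mx intr (t i))) in et.
pose r (i : 'I_(k + l)) :=
  match fintype.split i with inl i => v i | inr j => - t j end.
have rl i : r (lshift l i) = v i.
  by rewrite /r -[lshift l i]/(unsplit (inl i)) unsplitK.
have rr j : r (rshift k j) = - t j.
  by rewrite /r -[rshift k j]/(unsplit (inr j)) unsplitK.
have [u uP] := relative_interior R r.
have u0 i : 0 <= dot (v i) u by rewrite -rl; exact: (uP _).1.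
exists u; split.
- by rewrite es; apply/dual_pred_cone.
- rewrite et; apply/dual_pred_cone => j.
  by rewrite dotNr -dotNl -rr; exact: (uP _).1.
move=> w dw; rewrite es; apply: (@dual_shift _ _ (sigma `&` tau)) => // i.
rewrite -rl => /(uP _).2[c c0]; rewrite rl big_split_ord /=.
under eq_bigr do rewrite rl.
under [X in _ + X]eq_bigr do rewrite rr raddfN scalerN.
rewrite sumrN; set x := \sum_i _; set y := \sum_j _ => e.
have sx : sigma x by rewrite es; exists (fun i => c (lshift l i)).
have ty : tau y by rewrite et; exists (fun j => c (rshift k j)).
have ey : map_mx intr (v i) + x = y by rewrite -[x](subrK y) -e addNKr.
have sv : sigma (map_mx intr (v i)).
  by rewrite es; exact: (@cone_gen R k (fun i => map_mx intr (v i))).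
apply: (face_absorb fs sv sx); rewrite ey; split=> //.
rewrite -ey es; move: sv sx; rewrite es => -[c1 c10 ->] [c2 c20 ->].
exists (fun i => c1 i + c2 i) => [j|]; first exact: addr_ge0.
by rewrite -big_split; apply: eq_bigr => j _; rewrite scalerDl.
Qed.

End Fans.

(** * Points and sections of the monoscheme of a fan *)

Section DualMonoid.
Variables (R : realType) (n : nat) (sigma : set 'rV[R]_n).
Implicit Types (p : spec_pts (dual_monoid sigma)) (w : 'cV[int]_n).

Definition form (a : dual_monoid sigma) : 'cV[int]_n := sub_val a.

Definition mkform w (h : dual_pred sigma w) : dual_monoid sigma :=
  @mksub _ (Submonoid (@dual_pred0 R n sigma) (@dual_predD R n sigma)) w h.

Lemma form_inj : injective form. Proof. exact: val_inj. Qed.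

Lemma form0 : form 0 = 0. Proof. by []. Qed.

Lemma formD a b : form (a + b) = form a + form b. Proof. by []. Qed.

Lemma formMn a k : form (a *+ k) = form a *+ k.
Proof. by elim: k => // k IH; rewrite !mulrS formD IH. Qed.

Lemma form_mkform w (h : dual_pred sigma w) : form (mkform h) = w.
Proof. by []. Qed.

Lemma formP a : dual_pred sigma (form a).
Proof. exact: (sub_valS (a : sub_of _)). Qed.

(** The stalk of the structure sheaf at [p], as a submonoid of the lattice of
    all linear forms (see [germ_value_forms] and [germ_value_inj]). *)
Definition germ_forms p : set 'cV[int]_n :=
  [set w | exists a b, ~ p b /\ form a = w + form b].

Lemma germ_forms_dual p a : germ_forms p (form a).
Proof. by exists a, 0; split; [exact: compl0|rewrite form0 addr0]. Qed.

Lemma germ_forms0 p : germ_forms p 0.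
Proof. exact: (@germ_forms_dual p 0). Qed.

Lemma germ_formsD p w w' :
  germ_forms p w -> germ_forms p w' -> germ_forms p (w + w').
Proof.
move=> [a [b [pb eb]]] [c [d [pd ed]]]; exists (a + c), (b + d).
by split; [exact: complD|rewrite !formD eb ed addrACA].
Qed.

Lemma germ_formsMn p w k : germ_forms p w -> germ_forms p (w *+ k).
Proof.
move=> pw; elim: k => [|k IH]; first exact: germ_forms0.
by rewrite mulrS; exact: germ_formsD.
Qed.

(** As [- form b] is the inverse of [form b], this recovers the prime ideal from
    the units of the stalk. *)
Lemma germ_formsN p b : germ_forms p (- form b) <-> ~ p b.
Proof.
split=> [[c [d [pd e]]]|pb]; last first.
  by exists 0, b; split; rewrite // form0 addNr.
have ed : b + c = d by apply: form_inj; rewrite formD e addNKr.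
by move: pd; rewrite -ed => /complDl.
Qed.

Section Germs.
Variable p : spec_pts (dual_monoid sigma).

Definition germ_value (z : loc (compl p)) : 'cV[int]_n :=
  form (repr z).1 - form (sub_val (repr z).2).

Lemma germ_value_frac a b (pb : compl p b) :
  germ_value (frac (compl p) a pb) = form a - form b.
Proof.
have : fracs (repr (frac (compl p) a pb)) = frac (compl p) a pb.
  by rewrite /fracs reprK.
rewrite /germ_value; case: (repr _) => c d /fracsP[u _] /= /(congr1 form).
rewrite !formD -!addrA => /addrI e.
by apply/eqP; rewrite subr_eq addrAC -e addrK.
Qed.

Lemma germ_value_inj : injective germ_value.
Proof.
move=> z t; have [a [b [pb ->]]] := frac_surj z.
have [c [d [pd ->]]] := frac_surj t; rewrite !germ_value_frac => e.
apply/fracP; exists 0; first exact: compl0.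
apply: form_inj; rewrite !add0r !formD -[form a](subrK (form b)) e.
by rewrite addrAC subrK addrC.
Qed.

Lemma germ_valueD z t : germ_value (z + t) = germ_value z + germ_value t.
Proof.
have [a [b [pb ->]]] := frac_surj z; have [c [d [pd ->]]] := frac_surj t.
by rewrite fracD !germ_value_frac !formD opprD addrACA.
Qed.

Lemma germ_value_forms z : germ_forms p (germ_value z).
Proof.
have [a [b [pb ->]]] := frac_surj z; exists a, b; split=> //.
by rewrite germ_value_frac subrK.
Qed.

End Germs.

End DualMonoid.

Section FanPoints.
Variables (R : realType) (n : nat) (Sigma : fan R n).

Local Notation D := (fan_diagram Sigma).
Local Notation pt s := (spec_pts (dual_monoid (sval s))).
Local Notation fan_in s := (@glue_in D s).
Implicit Types (s t : {sigma | Sigma sigma}) (w : 'cV[int]_n).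

Lemma dual_pred_sub (sigma tau : set 'rV[R]_n) w :
  tau `<=` sigma -> dual_pred sigma w -> dual_pred tau w.
Proof. by move=> ts sw x tx; exact/sw/ts. Qed.

Lemma germ_value_step t s (h : face (sval t) (sval s))
    (p : pt t) z :
  germ_value (spec_stalk_map (dual_incl (face_sub h)) p z) = germ_value z.
Proof.
have [a [b [pb ->]]] := frac_surj z.
by rewrite spec_stalk_mapE !germ_value_frac.
Qed.

(** The embedding of a face [t] of [s] is a localization: a form on [t] becomes
    a form on [s] after adding a multiple of the form [u] that separates [s]
    from [t], and [u] is a unit in the monoid of [t]. *)
Lemma germ_forms_step t s (h : face (sval t) (sval s))
    (p : pt t) :
  germ_forms (spec_fun (dual_incl (face_sub h)) p) = germ_forms p.
Proof.
apply/seteqP; split=> w [a [b [pb e]]].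
  by exists (dual_incl (face_sub h) a), (dual_incl (face_sub h) b).
have [u [su tu sh]] := fan_separation (proj2_sig s) (proj2_sig t).
have ts : sval s `&` sval t = sval t.
  by apply/seteqP; split=> [x []|x tx] //; split=> //; exact: face_sub h x tx.
rewrite ts in sh; have [k ak] := sh _ (formP a); have [l bl] := sh _ (formP b).
have addu (v : 'cV[int]_n) j :
    dual_pred (sval s) v -> dual_pred (sval s) (v + u *+ j).
  move=> sv; elim: j => [|j IH]; first by rewrite addr0.
  by rewrite mulrSr addrA; exact: dual_predD.
exists (mkform (addu _ l ak)), (mkform (addu _ k bl)); split; last first.
  by rewrite !form_mkform e addrAC -!addrA.
move=> pbl; pose v := mkform (dual_pred_sub (face_sub h) su).
have uv : is_unit v.
  by exists (mkform tu); apply: form_inj; rewrite formD /= addrN.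
pose i := dual_incl (face_sub h).
have eb : i (mkform (addu _ k bl)) = b + v *+ (l + k).
  by apply: form_inj; rewrite formD formMn mulrnDr addrA.
have : compl p (b + v *+ (l + k)).
  apply: (smD (s := compl p)) => //.
  elim: (l + k)%N => [|j IH]; first exact: compl0.
  by rewrite mulrS; apply: (smD (s := compl p)) => //; exact: unit_compl.
by rewrite -eb.
Qed.

Definition forms_at (x : fan_monoscheme Sigma) : set 'cV[int]_n :=
  germ_forms (gpt (repr x) : pt (gix (repr x))).

Lemma forms_at_in s (p : pt s) :
  forms_at (fan_in s p) = germ_forms p.
Proof.
have /glue_in_eq : fan_in _ (gpt (repr (fan_in s p))) = fan_in s p.
  by rewrite -[RHS]reprK /glue_in; case: (repr _).
rewrite /forms_at; case: (repr _) => t q /= e.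
suff H (x y : glue_sum D) : clos_refl_sym_trans _ (@glue_step D) x y ->
    germ_forms (gpt x : pt (gix x)) =
    germ_forms (gpt y : pt (gix y)) by exact: (H _ _ e).
elim=> {x y} //= [_ _ [k l a r]|x y z _ -> _ ->] //=.
exact/esym/germ_forms_step.
Qed.

(** If [x] is in the chart of [t], then the form that separates [t] from [s] is
    regular at [x] together with its opposite, as the latter is a form on [s].
    Hence all forms on the intersection of the cones are regular at [x], which
    is therefore in the chart of the intersection. *)
Lemma in_chart s x : dual_pred (sval s) `<=` forms_at x ->
  exists p : pt s, x = fan_in s p.
Proof.
have [t [q ->]] := glue_in_surj x; rewrite forms_at_in => sq.
have [fs ft] := fan_inter (proj2_sig s) (proj2_sig t).
pose k : {sigma | Sigma sigma} :=
  exist _ (sval s `&` sval t) (fan_face (proj2_sig s) fs).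
have [u [tu su uP]] := fan_separation (proj2_sig t) (proj2_sig s).
have kq : dual_pred (sval k) `<=` germ_forms q.
  move=> w; rewrite /= setIC => /uP[j wj].
  rewrite -[w](addrK (u *+ j)) -mulNrn; apply: germ_formsD.
    exact: (germ_forms_dual q (mkform wj)).
  by apply: germ_formsMn; exact: sq.
pose r (a : dual_monoid (sval k)) :=
  ~ germ_forms q (- form a).
have rp : prime_ideal r.
  rewrite /r; split=> [a b na||a b nab].
  - rewrite formD => qab; apply: na.
    rewrite -[- form a](subrK (form b)) -opprD.
    by apply: germ_formsD => //; exact/kq/formP.
  - by rewrite form0 oppr0 => /(_ (germ_forms0 q)).
  - apply: contrapT => /not_orP[/contrapT qa /contrapT qb]; apply: nab.
    by rewrite formD opprD; exact: germ_formsD.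
pose pk : pt k := SpecPt rp.
have eq : q = spec_fun (dual_incl (face_sub ft)) pk.
  apply: spec_pts_ext => a; rewrite /= /r.
  rewrite -[form (dual_incl _ _)]/(form a) germ_formsN.
  by split=> [qa na|/contrapT].
exists (spec_fun (dual_incl (face_sub fs)) pk); rewrite eq.
by rewrite (@glue_in_mp D k t ft pk) (@glue_in_mp D k s fs pk).
Qed.

(** The lattice of forms identifies the stalks in all charts, and [in_chart]
    moves both points to one chart, where the prime ideal is recovered from the
    stalk by [germ_formsN]. *)
Lemma forms_at_inj x y : forms_at x = forms_at y -> x = y.
Proof.
have [s [q ->]] := glue_in_surj y => e.
have [|p ep] := @in_chart s x.
  by rewrite e forms_at_in => w sw; exact: (germ_forms_dual q (mkform sw)).
rewrite ep; congr glue_in; apply: spec_pts_ext => a.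
move: e; rewrite ep !forms_at_in => e.
have := germ_formsN p a; rewrite e germ_formsN => pq.
by split=> [pa|qa]; apply: contrapT => h; [have := pq.1 h|have := pq.2 h].
Qed.
End FanPoints.

Section FanSections.
Variables (R : realType) (n : nat) (Sigma : fan R n).

Local Notation X := (fan_monoscheme Sigma).
Local Notation D := (fan_diagram Sigma).
Local Notation pt s := (spec_pts (dual_monoid (sval s))).
Local Notation fan_in s := (@glue_in D s).
Implicit Types (s t : {sigma | Sigma sigma}) (w : 'cV[int]_n) (V W : opens X).

Definition section_value V (f : sec V) s (p : pt s) (Vp : V (fan_in s p)) :
    'cV[int]_n :=
  let fs : sub_of (spec_sec (gpre V s)) := sub_val (f : sub_of (glue_sec V)) s in
  germ_value (sub_val fs (exist _ p Vp)).

Arguments section_value {V} f s p Vp.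

Lemma section_value_irr V (f : sec V) s p (Vp Vp' : V (fan_in s p)) :
  section_value f s p Vp = section_value f s p Vp'.
Proof. by rewrite (Prop_irrelevance Vp Vp'). Qed.

Lemma section_value_ext V (f g : sec V) :
  (forall s p Vp, section_value f s p Vp = section_value g s p Vp) -> f = g.
Proof.
move=> fg; apply: val_inj; apply: functional_extensionality_dep => s.
by apply: spec_sec_ext => q Vq; apply: germ_value_inj; exact: (fg s q Vq).
Qed.

Lemma section_valueD V (f g : sec V) s p Vp :
  section_value (f + g) s p Vp = section_value f s p Vp + section_value g s p Vp.
Proof. exact: germ_valueD. Qed.

Lemma section_value_res V W (h : W `<=` V) (f : sec V) s p Wp Vp :
  section_value (res h f) s p Wp = section_value f s p Vp.
Proof.
rewrite /section_value /= /glue_fam_res /= /stalks_res /=.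
by rewrite (Prop_irrelevance (gpreS h Wp) Vp).
Qed.

(** The gluing maps are the identity on the lattice of linear forms, hence
    compatible sections over the charts have the same value at a point.  This
    makes sections over the monoscheme of a fan functions with values in the
    lattice. *)
Lemma section_value_in V (f : sec V) s t p q Vp Vq : fan_in s p = fan_in t q ->
  section_value f s p Vp = section_value f t q Vq.
Proof.
move=> /glue_in_eq e.
pose val (x : glue_sum D) (Vx : V (glue_in (gpt x))) :=
  section_value f (gix x) (gpt x) Vx.
suff H (x y : glue_sum D) : clos_refl_sym_trans _ (@glue_step D) x y ->
    forall Vx Vy, val x Vx = val y Vy by exact: (H _ _ e Vp Vq).
elim=> {x y} [_ _ [k l a r]|x|x y _ IH|x y z xy IH1 _ IH2] Vx Vy.
- have := sub_valS (f : sub_of (glue_sec V)) k l a (gpre_mp a).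
  move=> /(congr1 (fun g : sub_of (spec_sec (gpre V k)) =>
    germ_value (sub_val g (exist _ (r : pt k) Vx)))).
  rewrite /val /section_value => <-.
  rewrite /= /stalks_res /stalks_pull /= germ_value_step.
  by rewrite (Prop_irrelevance (gpre_mp a Vx) Vy).
- exact: section_value_irr.
- by rewrite (IH Vy Vx).
- have Vm : V (glue_in (gpt y)).
    suff <- : glue_in (gpt x) = glue_in (gpt y) by [].
    by apply/eqP; rewrite eqmodE; apply/asboolP; case: x y xy {IH1 IH2 Vx} => ? ? [].
  by rewrite (IH1 Vx Vm) (IH2 Vm Vy).
Qed.

Lemma forms_at_open w : open (fun x : X => forms_at x w).
Proof.
rewrite glue_openE => s; rewrite spec_openE => p /=.
rewrite forms_at_in => -[a [b [pb e]]]; exists b => // q /= qb.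
by rewrite (forms_at_in (s := s)); exists a, b.
Qed.

Definition forms_open w : opens X := Opens (@forms_at_open w).

Lemma regular_fracs w s (p : pt s) : forms_open w (fan_in s p) ->
  exists z : loc (compl p), germ_value z = w.
Proof.
rewrite /= forms_at_in => -[a [b [pb e]]]; exists (frac (compl p) a pb).
by rewrite germ_value_frac e addrK.
Qed.

Definition chi_stalks w s : stalks (gpre (forms_open w) s) :=
  fun x => sval (cid (@regular_fracs w s (sval x) (proj2_sig x))).

Arguments chi_stalks : clear implicits.

Lemma chi_stalksE w s x : germ_value (chi_stalks w s x) = w.
Proof. exact: proj2_sig (cid (regular_fracs _)). Qed.

Lemma locally_frac_chi w s : locally_frac (chi_stalks w s).
Proof.
move=> p Up; have := Up; rewrite /= forms_at_in => -[a [b [pb e]]].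
exists [set q | ~ q b], a, b; split=> //.
  by rewrite spec_openE => q qb; exists b.
move=> q Uq qb; exists qb; apply: germ_value_inj.
rewrite germ_value_frac e addrK.
exact: (chi_stalksE (exist _ q Uq)).
Qed.

Definition chi_fam w : glue_fam (forms_open w) :=
  fun s => @mksub _ (spec_sec (gpre (forms_open w) s)) _ (@locally_frac_chi w s).

Lemma chi_compat w : glue_compat (chi_fam w).
Proof.
move=> s t a h; apply: spec_sec_ext => q Uq; apply: germ_value_inj.
rewrite /= /stalks_res /stalks_pull /= germ_value_step.
by transitivity w; [|apply/esym]; exact: (chi_stalksE (exist _ _ _)).
Qed.

(** The linear form [w] as a section, like the character of a torus that it is
    for toric varieties, over the locus where it is regular. *)
Definition chi w : sec (forms_open w) :=
  @mksub _ (glue_sec (forms_open w)) _ (@chi_compat w).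

Lemma section_value_chi w s p Vp : section_value (chi w) s p Vp = w.
Proof. exact: (chi_stalksE (exist _ _ _)). Qed.

Lemma chiD w w' V (h : V `<=` forms_open w) (h' : V `<=` forms_open w')
    (k : V `<=` forms_open (w + w')) :
  res h (chi w) + res h' (chi w') = res k (chi (w + w')).
Proof.
apply: section_value_ext => s p Vp; rewrite section_valueD.
rewrite (section_value_res h (chi w) Vp (h _ Vp)).
rewrite (section_value_res h' (chi w') Vp (h' _ Vp)).
by rewrite (section_value_res k (chi _) Vp (k _ Vp)) !section_value_chi.
Qed.

Lemma germ_unit_chi w x : forms_open w x ->
  germ_unit x (chi w) <-> forms_at x (- w).
Proof.
move=> xw; split=> [[W [h [Wx [t e]]]]|xw'].
  have [s [p ex]] := glue_in_surj x; move: xw Wx; rewrite ex => xw Wx.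
  have := congr1 (fun f => section_value f s p Wx) e.
  rewrite section_valueD (section_value_res h (chi w) Wx xw) section_value_chi.
  have -> : section_value (0 : sec W) s p Wx = 0.
    by rewrite /section_value /= dprod0 /= frac0 germ_value_frac subrr.
  rewrite addrC => /eqP; rewrite addr_eq0 => /eqP <-.
  by rewrite forms_at_in; exact: germ_value_forms.
pose W := Opens (openI (oopen (forms_open w)) (oopen (forms_open (- w)))
  : open (fun y => forms_open w y /\ forms_open (- w) y)).
have h : W `<=` forms_open w by move=> y [].
have h' : W `<=` forms_open (- w) by move=> y [].
exists W, h; split; first by [].
exists (res h' (chi (- w))); apply: section_value_ext => s p Wp.
rewrite section_valueD (section_value_res h (chi w) Wp (h _ Wp)).
rewrite (section_value_res h' (chi _) Wp (h' _ Wp)) !section_value_chi addrN.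
by rewrite /section_value /= dprod0 /= frac0 germ_value_frac subrr.
Qed.

(** The value of a section is locally constant, since a section is locally a
    difference of two elements of the monoid of a chart. *)
Lemma sec_locally_chi V (f : sec V) x : V x -> exists w (W : opens X)
    (h : W `<=` V) (k : W `<=` forms_open w), W x /\ res h f = res k (chi w).
Proof.
have [s [p ->]] := glue_in_surj x => Vp; pose w := section_value f s p Vp.
pose U (y : X) := V y /\
  forall t q Vq, y = fan_in t q -> section_value f t q Vq = w.
have UP t q (Vq : V (fan_in t q)) : section_value f t q Vq = w -> U (fan_in t q).
  by move=> e; split=> // r u Vr er; rewrite -e; exact/esym/section_value_in.
have oU : open U.
  rewrite glue_openE => t; rewrite spec_openE => q [Vq e].
  have {}e := e t q Vq erefl.
  pose ft : sub_of (spec_sec (gpre V t)) := sub_val (f : sub_of (glue_sec V)) t.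
  have [W [a [b [oW Wq ef]]]] := sub_valS ft q Vq.
  move: (oW q Wq) (oopen (gpre V t) q Vq) => [c qc cW] [d qd dV].
  exists (c + d); first exact: complD.
  move=> r /= rcd; have Vr : V (fan_in t r).
    by apply: dV; rewrite /= addrC in rcd *; exact: complDl rcd.
  have Wr : W r by apply: cW; exact: complDl rcd.
  apply: (UP t r Vr); rewrite -e /section_value.
  have [rb ->] := ef r Vr Wr; have [qb ->] := ef q Vq Wq.
  by rewrite !germ_value_frac.
have h : Opens oU `<=` V by move=> y [].
have k : Opens oU `<=` forms_open w.
  move=> y; have [t [q ->]] := glue_in_surj y => -[Vq e].
  rewrite -(e t q Vq erefl) /= forms_at_in; exact: germ_value_forms.
exists w, (Opens oU), h, k; split; first exact: (UP s p Vp).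
apply: section_value_ext => t q Uq; rewrite (section_value_res h f Uq (h _ Uq)).
rewrite (section_value_res k (chi w) Uq (k _ Uq)) section_value_chi.
by have [_ e] := Uq; apply: e.
Qed.

(** The sections [chi w] suffice to compare pullbacks by [sec_locally_chi]. *)
Lemma mor_fan_ext (T : lms) (g g' : mor T X) : (forall x, g x = g' x) ->
  (forall x w, forms_at (g x) w -> exists (W : opens T)
     (h : W `<=` opens_preim (mcont g) (forms_open w))
     (k : W `<=` opens_preim (mcont g') (forms_open w)),
     W x /\ res h (pull g _ (chi w)) = res k (pull g' _ (chi w))) ->
  g = g'.
Proof.
move=> pts loc; apply: mor_ext => // V f W h k.
pose im (x : {x | W x}) (N : opens T) := N (sval x) /\ exists l : N `<=` W,
  res l (res h (pull g V f)) = res l (res k (pull g' V f)).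
have /boolp.choice[N NP] x : exists N, im x N.
  case: x => x Wx; have [w [O [OV [Ow [Ox e]]]]] := sec_locally_chi f (h _ Wx).
  have [Z [hZ [kZ [Zx eZ]]]] := loc x w (Ow _ Ox).
  pose N := Opens (openI (openI (oopen W) (oopen Z))
      (oopen (opens_preim (mcont g) O))
    : open (fun y => (W y /\ Z y) /\ O (g y))).
  have NW : N `<=` W by move=> y [[]].
  have NZ : N `<=` Z by move=> y [[]].
  exists N; split; first by [].
  exists NW.
  have Ng : N `<=` opens_preim (mcont g) O by move=> y [].
  have Ng' : N `<=` opens_preim (mcont g') O by move=> y [_]; rewrite /= pts.
  have red (g0 : mor T X) (h0 : W `<=` opens_preim (mcont g0) V)
      (Z0 : Z `<=` opens_preim (mcont g0) (forms_open w))
      (N0 : N `<=` opens_preim (mcont g0) O) :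
    res NW (res h0 (pull g0 V f)) = res NZ (res Z0 (pull g0 _ (chi w))).
    have k1 : opens_preim (mcont g0) O `<=` opens_preim (mcont g0) V.
      by move=> y /OV.
    have k2 : opens_preim (mcont g0) O `<=` opens_preim (mcont g0) (forms_open w).
      by move=> y /Ow.
    rewrite (res_comp _ _ (subset_trans N0 k1)) -(res_comp k1 N0) -(pull_res OV) e.
    rewrite (pull_res _ k2) (res_comp _ _ (subset_trans N0 k2)).
    by rewrite (res_comp _ _ (subset_trans NZ Z0)); exact: res_irr.
  by rewrite (red g h hZ Ng) (red g' k kZ Ng') eZ.
have NW x : N x `<=` W by have [_ []] := NP x.
apply: (sec_ext (VU := NW)) => [x Wx|x].
  by exists (exist _ x Wx) => //; have [] := NP (exist _ x Wx).
by have [_ [l e]] := NP x; rewrite !(res_irr (NW x) l).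
Qed.

End FanSections.

Arguments chi {R n Sigma} w.

(** * Morphisms from spectra to the monoscheme of a fan *)

Lemma additive_of (U V : nmodType) (f : U -> V) :
  nmod_morphism f -> exists F : {additive U -> V}, F =1 f.
Proof.
move=> fD.
by exists (HB.pack_for {additive U -> V} f (GRing.isNmodMorphism.Build U V f fD)).
Qed.

Lemma to_gpD (M : nmodType) (a b : M) : to_gp (a + b) = to_gp a + to_gp b.
Proof.
rewrite [RHS]fracD; apply/fracP; exists 0 => //; by rewrite !addr0.
Qed.

Lemma to_gp0 (M : nmodType) : to_gp (0 : M) = 0.
Proof. by rewrite [RHS]frac0. Qed.

HB.instance Definition _ (M : nmodType) :=
  GRing.isNmodMorphism.Build M (gp M) (@to_gp M) (conj (@to_gp0 M) (@to_gpD M)).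

Section FanMorphismsFromSpectra.
Variables (R : realType) (n : nat) (Sigma : fan R n).

Local Notation X := (fan_monoscheme Sigma).
Local Notation D := (fan_diagram Sigma).
Local Notation pt s := (spec_pts (dual_monoid (sval s))).
Local Notation fan_in s := (@glue_in D s).
Implicit Types (s t : {sigma | Sigma sigma}) (w : 'cV[int]_n).

Lemma pull_chiD (T : lms) (g : mor T X) w w' (W : opens T)
    (h : W `<=` opens_preim (mcont g) (forms_open Sigma w))
    (h' : W `<=` opens_preim (mcont g) (forms_open Sigma w'))
    (k : W `<=` opens_preim (mcont g) (forms_open Sigma (w + w'))) :
  res h (pull g _ (chi w)) + res h' (pull g _ (chi w')) =
  res k (pull g _ (chi (w + w'))).
Proof.
pose O := Opens (openI (openI (oopen (forms_open Sigma w))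
    (oopen (forms_open Sigma w'))) (oopen (forms_open Sigma (w + w')))
  : open (fun y => (forms_open Sigma w y /\ forms_open Sigma w' y) /\
                   forms_open Sigma (w + w') y)).
have O1 : O `<=` forms_open Sigma w by move=> y [[]].
have O2 : O `<=` forms_open Sigma w' by move=> y [[]].
have O3 : O `<=` forms_open Sigma (w + w') by move=> y [].
have WO : W `<=` opens_preim (mcont g) O.
  by move=> y Wy; do !split; [exact: h|exact: h'|exact: k].
have red v (l : W `<=` opens_preim (mcont g) (forms_open Sigma v))
    (Ov : O `<=` forms_open Sigma v) :
    res l (pull g _ (chi v)) = res WO (pull g _ (res Ov (chi v))).
  have m : opens_preim (mcont g) O `<=` opens_preim (mcont g) (forms_open Sigma v).
    by move=> y; exact: Ov.
  by rewrite (pull_res _ m) (res_comp _ _ l).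
by rewrite (red _ h O1) (red _ h' O2) (red _ k O3) -!raddfD (chiD O1 O2 O3).
Qed.

Lemma chi0 : chi 0 = 0 :> sec (forms_open Sigma 0).
Proof.
apply: section_value_ext => s p Vp; rewrite section_value_chi.
by rewrite /section_value /= dprod0 /= frac0 germ_value_frac subrr.
Qed.

Section Chart.
Variables (s : {sigma | Sigma sigma}) (Q : nmodType).
Variable phi : {additive dual_monoid (sval s) -> Q}.

Lemma chart_regular (q : spec Q) (a : dual_monoid (sval s)) :
  forms_at (mor_comp (fan_chart s) (spec_map phi) q) (form a).
Proof. rewrite forms_at_in; exact: germ_forms_dual. Qed.

Lemma pull_chart_chi (a : dual_monoid (sval s)) (W : opens (spec Q))
    (h : W `<=` opens_preim (mcont (mor_comp (fan_chart s) (spec_map phi)))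
       (forms_open Sigma (form a))) :
  res h (pull (mor_comp (fan_chart s) (spec_map phi)) _ (chi (form a))) =
  const_sec W (phi a).
Proof.
have k : W `<=` opens_preim (mcont (spec_map phi))
    (opens_preim (mcont (fan_chart s)) (forms_open Sigma (form a))) := h.
rewrite (pull_comp _ h k).
have -> : pull (fan_chart s) (forms_open Sigma (form a)) (chi (form a)) =
    const_sec (opens_preim (mcont (fan_chart s)) (forms_open Sigma (form a))) a.
  apply: spec_sec_ext => p Up; apply: germ_value_inj.
  rewrite [RHS]germ_value_frac form0 subr0.
  exact: (@section_value_chi _ _ _ (form a) s p Up).
by rewrite pull_const_sec res_const_sec.
Qed.

End Chart.

(** If the chart of [s] contains the image of the closed point, it contains the
    image of every point, so that the forms on [s] may be pulled back to global
    sections over the spectrum, which are elements of [Q].  The points in the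
    image are recovered from [phi] as [g] is local: a form is a unit at the
    image of [q] if and only if its pullback is a unit at [q]. *)
Lemma mor_spec_fan (Q : nmodType) (g : mor (spec Q) X) :
  exists s (phi : {additive dual_monoid (sval s) -> Q}),
    g = mor_comp (fan_chart s) (spec_map phi).
Proof.
pose c := closed_point Q; have [s [p gc]] := glue_in_surj (g c).
have reg_c (a : dual_monoid (sval s)) : forms_at (g c) (form a).
  by rewrite gc forms_at_in; exact: (germ_forms_dual p a).
have reg (a : dual_monoid (sval s)) (q : spec Q) : forms_at (g q) (form a).
  exact: (@closed_point_open _ (opens_preim (mcont g) (forms_open Sigma (form a))) q
    (reg_c a)).
have /boolp.choice[phi phiP] (a : dual_monoid (sval s)) : exists z,
    pull g (forms_open Sigma (form a)) (chi (form a)) = const_sec _ z.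
  by apply: sec_closed_point; exact: reg_c.
pose T : opens (spec Q) := Opens openT.
have TT (a : dual_monoid (sval s)) :
    T `<=` opens_preim (mcont g) (forms_open Sigma (form a)).
  by move=> q _; exact: reg.
have phiT a : res (TT a) (pull g _ (chi (form a))) = const_sec T (phi a).
  by rewrite phiP res_const_sec.
have phi_add : nmod_morphism phi.
  split=> [|a b]; apply: (@const_sec_inj _ T) => //.
    rewrite -phiT.
    have -> : chi (form (0 : dual_monoid (sval s))) = 0 :> sec (forms_open Sigma _).
      by rewrite form0 chi0.
    by rewrite !raddf0; apply: spec_sec_ext => q Uq; rewrite [LHS]frac0.
  by rewrite const_secD -!phiT (pull_chiD _ _ (TT (a + b))).
have [F FE] := additive_of phi_add; exists s, F.
set g' := mor_comp _ _.
have ptE q : g q = g' q.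
  have [r gq] : exists r : pt s, g q = fan_in s r.
    by apply: in_chart => w sw; exact: (reg (mkform sw)).
  rewrite gq; congr (fan_in s); apply: spec_pts_ext => a /=; rewrite FE.
  suff [h1 h2] : ~ r a <-> ~ q (phi a).
    by split=> h; apply: contrapT => k; [exact: h2 k h|exact: h1 k h].
  rewrite -germ_formsN -(forms_at_in (s := s)) -gq.
  rewrite -(germ_unit_chi (reg a q : forms_open Sigma (form a) (g q))).
  have Uq : opens_preim (mcont g) (forms_open Sigma (form a)) q := reg a q.
  rewrite -(germ_unit_const _ Uq) -phiP.
  by split=> [|u]; [exact: germ_unit_pull|exact: mlocal u].
apply: mor_fan_ext => // q w.
have [r gq] : exists r : pt s, g q = fan_in s r.
  by apply: in_chart => v sv; exact: (reg (mkform sv)).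
move=> qw; have := qw; rewrite gq forms_at_in => -[a [b [rb e]]].
have qb : forms_at (g q) (- form b) by rewrite gq forms_at_in germ_formsN.
pose W : opens (spec Q) := opens_preim (mcont g) (forms_open Sigma (- form b)).
have Wg v : (forall x, W x -> forms_at (g x) v) ->
    W `<=` opens_preim (mcont g) (forms_open Sigma v) by [].
have Wg' v : (forall x, W x -> forms_at (g x) v) ->
    W `<=` opens_preim (mcont g') (forms_open Sigma v).
  by move=> h x Wx; have := h x Wx; rewrite ptE.
have rb' x : W x -> forms_at (g x) (- form b) by [].
have ra x : W x -> forms_at (g x) (form a) by move=> _; exact: reg.
have rb'' x : W x -> forms_at (g x) (form b) by move=> _; exact: reg.
have rw x : W x -> forms_at (g x) (form a + - form b).
  by move=> Wx; exact: germ_formsD (ra x Wx) (rb' x Wx).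
have r0 x : W x -> forms_at (g x) (form b + - form b).
  by move=> Wx; exact: germ_formsD (rb'' x Wx) (rb' x Wx).
have {qw} -> : w = form a + - form b by rewrite e addrK.
exists W, (Wg _ rw), (Wg' _ rw); split=> //.
rewrite -(pull_chiD (Wg _ ra) (Wg _ rb')) -(pull_chiD (Wg' _ ra) (Wg' _ rb')).
have same (d : dual_monoid (sval s)) (k : forall x, W x -> forms_at (g x) (form d)) :
    res (Wg _ k) (pull g _ (chi (form d))) = res (Wg' _ k) (pull g' _ (chi (form d))).
  by rewrite phiP res_const_sec (pull_chart_chi (phi := F)) FE.
rewrite (same a ra); congr (_ + _).
have zero (g0 : mor (spec Q) X)
    (l : W `<=` opens_preim (mcont g0) (forms_open Sigma (form b + - form b))) :
    res l (pull g0 _ (chi (form b + - form b))) = 0.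
  move: l; rewrite addrN => l.
  by rewrite chi0 !raddf0.
apply: (@unit_inv_uniq _ (res (Wg _ rb'') (pull g _ (chi (form b))))).
  by rewrite (pull_chiD _ _ (Wg _ r0)) zero.
by rewrite (same b rb'') (pull_chiD _ _ (Wg' _ r0)) zero.
Qed.

Lemma chart_mor_compat s t (Q : nmodType)
    (phi : {additive dual_monoid (sval s) -> Q})
    (psi : {additive dual_monoid (sval t) -> Q}) :
  mor_comp (fan_chart s) (spec_map phi) = mor_comp (fan_chart t) (spec_map psi) ->
  forall a b c, form a + form b = form c -> psi a + phi b = phi c.
Proof.
move=> e a b c eabc; pose T : opens (spec Q) := Opens openT.
set g := mor_comp (fan_chart s) _ in e.
pose g' := mor_comp (fan_chart t) (spec_map psi).
have Ts (d : dual_monoid (sval s)) :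
    T `<=` opens_preim (mcont g) (forms_open Sigma (form d)).
  by move=> q _; exact: (chart_regular phi q d).
have Tt' : T `<=` opens_preim (mcont g') (forms_open Sigma (form a)).
  by move=> q _; exact: (chart_regular psi q a).
have Tt : T `<=` opens_preim (mcont g) (forms_open Sigma (form a)).
  by move=> q Tq; have := Tt' q Tq; rewrite /g' -e.
have Tc : T `<=` opens_preim (mcont g) (forms_open Sigma (form a + form b)).
  by rewrite eabc; exact: Ts.
apply: (@const_sec_inj _ T) => //; rewrite const_secD.
rewrite -(pull_chart_chi (Ts b)) -(pull_chart_chi Tt') -(mor_eq_pull e _ Tt).
rewrite (pull_chiD _ _ Tc) -(pull_chart_chi (Ts c)).
by move: Tc; rewrite eabc => Tc; exact: res_irr.
Qed.

Lemma form_difference s w :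
  exists ab : dual_monoid (sval s) * dual_monoid (sval s),
    form ab.1 = w + form ab.2.
Proof.
have [rp sc] := fan_cone (proj2_sig s); have [u du uP] := dual_generates rp sc.
have [k wk] := uP w; exists (mkform wk, mkform du *+ k).
by rewrite formMn.
Qed.

(** A homomorphism to a group extends because the forms on a strongly convex
    cone generate the lattice. *)
Lemma form_extension s (G : zmodType)
    (phi : {additive dual_monoid (sval s) -> G}) :
  exists Phi : {additive 'cV[int]_n -> G}, forall a, Phi (form a) = phi a.
Proof.
have indep a b a' b' : form a + form b' = form a' + form b ->
    phi a - phi b = phi a' - phi b' :> G.
  rewrite -!formD => /form_inj /(congr1 phi); rewrite !raddfD => e.
  by apply/eqP; rewrite subr_eq addrAC -e addrK.
have [f fP] := boolp.choice (form_difference s).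
have Fadd : nmod_morphism (fun w => phi (f w).1 - phi (f w).2).
  split=> [|w w'].
    by rewrite (@indep _ _ 0 0) ?subrr // form0 addr0 add0r fP add0r.
  rewrite addrACA -opprD -!raddfD; apply: indep.
  by rewrite !formD !fP addrAC [RHS](AC (2*2*1) ((1*3)*(2*4)*5)).
have [F FE] := additive_of Fadd; exists F => a; rewrite FE.
by rewrite (@indep _ _ a 0) ?raddf0 ?oppr0 ?addr0.
Qed.

(** All the forms on [s] and on [t] are pulled back to global sections by the
    same morphism, and the relations between them in the lattice are preserved.
    As the forms on [s] generate the lattice, those on [t] have the values
    given by [Phi]. *)
Lemma chart_mor_lattice s t (Q : nmodType)
    (phi : {additive dual_monoid (sval s) -> Q})
    (psi : {additive dual_monoid (sval t) -> Q})
    (Phi : {additive 'cV[int]_n -> gp Q}) :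
  mor_comp (fan_chart s) (spec_map phi) = mor_comp (fan_chart t) (spec_map psi) ->
  (forall a, to_gp (phi a) = Phi (form a)) ->
  forall a, to_gp (psi a) = Phi (form a).
Proof.
move=> e phiE a; have [[c b] /= cb] := form_difference s (form a).
have := chart_mor_compat e (esym cb) => /(congr1 (@to_gp Q)).
by rewrite raddfD /= !phiE cb raddfD => /addIr.
Qed.

(** The form that separates the cones is nonnegative on [s] and nonpositive on
    [t], hence it is mapped to a unit of [Q], and both morphisms factor through
    the chart of the intersection. *)
Lemma chart_mor_eq s t (Q : nmodType)
    (phi : {additive dual_monoid (sval s) -> Q})
    (psi : {additive dual_monoid (sval t) -> Q})
    (Phi : {additive 'cV[int]_n -> gp Q}) : integral Q ->
  (forall a, to_gp (phi a) = Phi (form a)) ->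
  (forall a, to_gp (psi a) = Phi (form a)) ->
  mor_comp (fan_chart s) (spec_map phi) = mor_comp (fan_chart t) (spec_map psi).
Proof.
move=> iQ phiE psiE; have [fs ft] := fan_inter (proj2_sig s) (proj2_sig t).
pose k : {sigma | Sigma sigma} :=
  exist _ (sval s `&` sval t) (fan_face (proj2_sig s) fs).
have [u [su tu uP]] := fan_separation (proj2_sig s) (proj2_sig t).
have /boolp.choice[theta thetaE] (a : dual_monoid (sval k)) :
    exists z, to_gp z = Phi (form a).
  have [j aj] := uP _ (formP a).
  exists (phi (mkform aj) + psi (mkform tu) *+ j).
  rewrite raddfD raddfMn /= phiE psiE -raddfMn -raddfD.
  by rewrite !form_mkform mulNrn addrK.
have thetaD : nmod_morphism theta.
  by split=> [|a b]; apply: iQ; rewrite ?raddfD /= !thetaE ?raddf0 ?raddfD.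
have [F FE] := additive_of thetaD.
have fac (r : {sigma | Sigma sigma}) (fr : face (sval k) (sval r))
    (rho : {additive dual_monoid (sval r) -> Q}) :
    (forall a, to_gp (rho a) = Phi (form a)) ->
    mor_comp (fan_chart r) (spec_map rho) = mor_comp (fan_chart k) (spec_map F).
  move=> rhoE; rewrite /fan_chart -(@glue_inj_mp D k r fr) -mor_compA.
  congr mor_comp; apply/esym; apply: spec_map_comp => a.
  by apply: iQ; rewrite rhoE FE thetaE.
by rewrite (fac s fs phi) // (fac t ft psi).
Qed.

End FanMorphismsFromSpectra.

(** * Subdivisions *)

Section Subdivisions.
Variables (R : realType) (n m : nat) (Delta : fan R n) (Sigma : fan R m).
Variable f : fan_mor Delta Sigma.

Local Notation A := (lat f).
Local Notation real := (map_mx (intr : int -> R)).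

Lemma partial_subdivision_inverse : partial_subdivision f ->
  exists2 B : 'M[int]_(m, n), A *m B = 1%:M & B *m A = 1%:M.
Proof.
move=> [g fg gf]; pose B : 'M[int]_(m, n) := \matrix_i g (delta_mx 0 i).
have BA : B *m A = 1%:M.
  by apply/row_matrixP => i; rewrite row_mul rowK gf row1.
exists B => //; apply/row_matrixP => i; apply: (can_inj fg).
by rewrite row_mul -mulmxA BA mulmx1 row1 rowE.
Qed.

Lemma fan_map_local (Q : nmodType) (s : {sigma | Delta sigma})
    (phi : {additive dual_monoid (sval s) -> Q}) :
  exists (t : {sigma | Sigma sigma})
    (h : [set x *m real A | x in sval s] `<=` sval t),
    mor_comp (fan_map f) (mor_comp (fan_chart s) (spec_map phi)) =
    mor_comp (fan_chart t) (spec_map (phi \o dual_map h)).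
Proof.
have [tau St h] := lat_cone f (proj2_sig s).
pose t : {sigma | Sigma sigma} := exist _ tau St; exists t, h.
rewrite mor_compA (fan_map_chart (sigma' := t) h) -mor_compA; congr mor_comp.
exact: spec_map_comp.
Qed.

Section Lattice.
Variable B : 'M[int]_(m, n).
Hypotheses (AB : A *m B = 1%:M) (BA : B *m A = 1%:M).

(** Every form on [s] is the difference of two pullbacks of forms on [t],
    because the forms on [t] generate the lattice. *)
Lemma lattice_pullback (Q : nmodType) (s : {sigma | Delta sigma})
    (t : {sigma | Sigma sigma})
    (h : [set x *m real A | x in sval s] `<=` sval t)
    (phi : {additive dual_monoid (sval s) -> Q})
    (Phi : {additive 'cV[int]_m -> gp Q}) :
  (forall a, to_gp (phi (dual_map h a)) = Phi (form a)) ->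
  forall a, to_gp (phi a) = Phi (B *m form a).
Proof.
move=> phiE a; have [[c d] /= cd] := form_difference t (B *m form a).
have e : dual_map h c = a + dual_map h d.
  apply: form_inj; rewrite formD -[form (dual_map h c)]/(A *m form c).
  by rewrite -[form (dual_map h d)]/(A *m form d) cd mulmxDr mulmxA AB mul1mx.
have := phiE c; rewrite e !raddfD /= phiE cd raddfD; exact: addIr.
Qed.

(** On the spectra of integral monoids that cover [T], a morphism is determined
    by the map it induces on the lattice, and the composition with a partial
    subdivision does not lose this map. *)
Lemma fan_map_mono (T : lms) (b c : mor T (fan_monoscheme Delta)) :
  saturated_monoscheme T ->
  mor_comp (fan_map f) b = mor_comp (fan_map f) c -> b = c.
Proof.
move=> satT bc; apply: mor_eq_local => x.
have [Q [j [[iQ _] oj jx]]] := satT x; exists (spec Q), j; split=> //.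
have [s [phi es]] := mor_spec_fan (mor_comp b j).
have [t [psi et]] := mor_spec_fan (mor_comp c j).
have [s' [hs es']] := fan_map_local phi; have [t' [ht et']] := fan_map_local psi.
have [Phi PhiE] := form_extension (@to_gp Q \o (phi \o dual_map hs)).
have PsiE : forall a, to_gp (psi (dual_map ht a)) = Phi (form a).
  apply: (@chart_mor_lattice _ _ _ s' t' Q
    (phi \o dual_map hs) (psi \o dual_map ht)).
    by rewrite -es' -et' -es -et !mor_compA bc.
  by move=> a; rewrite PhiE.
rewrite es et; apply: (@chart_mor_eq _ _ _ s t Q phi psi (Phi \o mulmx B) iQ).
  by apply: (@lattice_pullback _ _ _ hs) => a; rewrite PhiE.
exact: (@lattice_pullback _ _ _ ht).
Qed.

(** The valuative criterion for cones.  If every cone [s] of the subdivision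
    had a form [u s] that is negative for the valuation, then by Ville's
    theorem either some point of the cone [t] would be negative on all [u s],
    although it lies in one of the cones, or some nontrivial nonnegative
    combination of the [u s] would be in the dual of [t], although its value is
    negative.  Nontrivial means that some coefficient is positive, and the sign
    of the value is strict because [- Phi (B *m u s)] is in [P] but its opposite
    is not. *)
Lemma valuative_cone (P : nmodType) (t : {sigma | Sigma sigma})
    (Phi : {additive 'cV[int]_m -> gp P}) :
  subdivision f -> valuative P ->
  (forall a : dual_monoid (sval t), range (@to_gp P) (Phi (form a))) ->
  exists s : {sigma | Delta sigma}, forall a : dual_monoid (sval s),
    range (@to_gp P) (Phi (B *m form a)).
Proof.
move=> [_ supp] [_ val] posP; apply: contrapT => none.
have rangeD z z' : range (@to_gp P) z -> range (@to_gp P) z' ->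
    range (@to_gp P) (z + z').
  by move=> [a _ <-] [b _ <-]; exists (a + b); rewrite ?raddfD.
have rangeMn z k : range (@to_gp P) z -> range (@to_gp P) (z *+ k).
  by move=> [a _ <-]; exists (a *+ k); rewrite ?raddfMn.
have [L eL] := (finite_seqP _).1 (fan_finite Delta).
have DL j : Delta (nth set0 L j) <-> (nth set0 L j \in L).
  by rewrite -[Delta _]/((Delta : set _) _) eL.
have /boolp.choice[u uP] (j : 'I_(size L)) : exists u : 'cV[int]_n,
    dual_pred (nth set0 L j) u /\ ~ range (@to_gp P) (Phi (B *m u)).
  apply: contrapT => nu; apply: none.
  have Dj : Delta (nth set0 L j) by apply/DL/mem_nth.
  exists (exist _ _ Dj) => a; apply: contrapT => na; apply: nu.
  by exists (form a); split=> //; exact: formP.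
have negu j : range (@to_gp P) (- Phi (B *m u j)).
  by have [/(uP j).2[]|] := val (Phi (B *m u j)).
have [[k [v ev]] _] := fan_cone (proj2_sig t).
rewrite -[X in _ = X]/(cone (fun i => map_mx intr (v i))) in ev.
have [[c c0 neg]|[y [j0 yj0] pos]] :=
    ville R (\matrix_(i, j) (dot (v i) (B *m u j)) : 'M_(k, size L)).
  pose x := \sum_i c i *: real (v i).
  have : support Sigma x.
    by exists (sval t); [exact: proj2_sig|rewrite ev; exists c].
  rewrite -supp => -[z [sigma Ds sz] zx].
  have Ls : sigma \in L by move: Ds; rewrite -[Delta _]/((Delta : set _) _) eL.
  have Lj : (index sigma L < size L)%N by rewrite index_mem.
  have := neg (Ordinal Lj); rewrite ltNge => /negP; apply.
  have := (uP (Ordinal Lj)).1; rewrite /= nth_index // => /(_ z sz).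
  rewrite -[X in real X](mul1mx (u _)) -AB -mulmxA map_mxM mulmxA zx /x dot_suml.
  by congr (_ <= _); apply: eq_bigr => i _; rewrite dotZl dot_real mxE.
have dw : dual_pred (sval t) (\sum_j (B *m u j) *+ y j).
  rewrite ev; apply/dual_pred_cone => i; rewrite dot_sumr.
  by have := pos i; congr (_ <= _); apply: eq_bigr => j _; rewrite mxE dotMn.
have [_] := uP j0; apply.
(* With w the sum, Phi w = \sum_j y j * Phi (B *m u j) is solved for a term of
   index j0, which has a positive coefficient. *)
have -> : Phi (B *m u j0) = Phi (\sum_j (B *m u j) *+ y j) +
    (\sum_(j | j != j0) (- Phi (B *m u j)) *+ y j +
     (- Phi (B *m u j0)) *+ (y j0).-1).
  rewrite raddf_sum (bigD1 j0) //= raddfMn /=.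
  under [X in _ + (X + _)]eq_bigr do rewrite mulNrn -raddfMn.
  by rewrite sumrN addrA addrK mulNrn -[X in _ *+ X - _](prednK yj0) mulrS addrK.
apply: (rangeD); first exact: (posP (mkform dw)).
apply: (rangeD); last exact: rangeMn.
apply: (big_ind (range (@to_gp P))) => [|z z'|j _]; [|exact: rangeD|exact: rangeMn].
by exists 0; rewrite ?raddf0.
Qed.

Lemma valuative_lift (P : nmodType) (g : mor (spec P) (fan_monoscheme Sigma)) :
  subdivision f -> valuative P ->
  exists h : mor (spec P) (fan_monoscheme Delta), mor_comp (fan_map f) h = g.
Proof.
move=> subd valP; have [iP _] := valP.
have [t [phi ->]] := mor_spec_fan g.
have [Phi PhiE] := form_extension (@to_gp P \o phi).
have [|s sP] := @valuative_cone P t Phi subd valP.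
  by move=> a; rewrite PhiE; exists (phi a).
have /boolp.choice[psi psiE] (a : dual_monoid (sval s)) :
    exists z, to_gp z = Phi (B *m form a).
  by have [z _ <-] := sP a; exists z.
have psiD : nmod_morphism psi.
  split=> [|a b]; apply: iP; rewrite ?raddfD /= !psiE.
    by rewrite form0 mulmx0 !raddf0.
  by rewrite formD mulmxDr raddfD.
have [F FE] := additive_of psiD; exists (mor_comp (fan_chart s) (spec_map F)).
have [t' [h ->]] := fan_map_local F.
apply: (chart_mor_eq (Phi := Phi)) => // a /=.
rewrite FE psiE -[form (dual_map h a)]/(A *m form a).
by rewrite mulmxA BA mul1mx.
Qed.

End Lattice.

End Subdivisions.

(** * Spectra of valuative monoids *)

Lemma valuative_saturated (P : nmodType) : valuative P -> saturated P.
Proof.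
move=> [iP val]; split=> // z k k0 [a _ az].
have [//|[b _ bz]] := val z; exists (a + b *+ k.-1) => //.
rewrite raddfD raddfMn /= az bz mulNrn -(prednK k0) mulrS.
by rewrite /= addrK.
Qed.

Theorem theorem3p21 (R : realType) (n m : nat)
    (Delta : fan R n) (Sigma : fan R m) (f : fan_mor Delta Sigma)
    (P : nmodType) (g : mor (spec P) (fan_monoscheme Sigma)) :
  subdivision f -> valuative P ->
  (exists (X : lms) (p : mor X (spec P)) (q : mor X (fan_monoscheme Delta)),
     saturated_fiber_product g (fan_map f) p q) /\
  (forall (X : lms) (p : mor X (spec P)) (q : mor X (fan_monoscheme Delta)),
     saturated_fiber_product g (fan_map f) p q -> is_iso p).
Proof.
move=> subd valP; have [B AB BA] := partial_subdivision_inverse subd.1.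
have [h hg] := valuative_lift AB BA g subd valP.
have mono := fan_map_mono AB.
have satP : saturated_monoscheme (spec P).
  move=> x; exists P, (mor_id (spec P)).
  by split; [exact: valuative_saturated|exact: open_immersion_id|exists x].
split.
  exists (spec P), (mor_id (spec P)), h; split=> //.
    by rewrite mor_comp_idr hg.
  move=> T a b satT ab; exists a; split; last by move=> u []; rewrite mor_comp_idl.
  split; first exact: mor_comp_idl.
  by apply: mono => //; rewrite mor_compA hg.
move=> X p q [satX gpfq univ].
have [|u [[pu qu] _]] := univ (spec P) (mor_id (spec P)) h satP.
  by rewrite mor_comp_idr hg.
exists u; split=> //; have [v [_ vuniq]] := univ X p q satX gpfq.
rewrite -(vuniq (mor_comp u p)); last first.
  rewrite !mor_compA pu mor_comp_idl qu; split=> //.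
  by apply: mono => //; rewrite mor_compA hg.
by apply: vuniq; rewrite !mor_comp_idr.
Qed.
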